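(* For all $x>0$ and all values of the parameters $\sigma>0$, $y>0$, and $\varepsilon\in(0,1)$: (I) $\mathrm{Pin}(x)\le\mathrm{PU}(x)\le\mathrm{BH}(x)$ and $\mathrm{Be}(x)\le\min\big(\mathrm{Ca}(x),\mathrm{BH}(x)\big)$; (II) $\mathrm{Be}(x)=\mathrm{Ca}(x)$ for all $x\in[0,y]$; (III) $\mathrm{BH}(x)$ increases from $\mathrm{EN}(x)$ to $1$ as $y$ increases from $0$ to $\infty$; (IV) there exists some $u_{y/\sigma}\in(0,\infty)$ that depends only on the ratio $y/\sigma$ such that $\mathrm{Ca}(x)<\mathrm{BH}(x)$ if $x\in(0,\sigma u_{y/\sigma})$ and $\mathrm{Ca}(x)>\mathrm{BH}(x)$ if $x\in(\sigma u_{y/\sigma},\infty)$; moreover, $u_{y/\sigma}$ increases from $u_{0+}=1.585\dots$ to $\infty$ as $y/\sigma$ increases from $0$ to $\infty$; in particular, $\mathrm{Ca}(x)<\mathrm{EN}(x)$ if $x/\sigma\in(0,1.585)$ and $\mathrm{Ca}(x)>\mathrm{EN}(x)$ if $x/\sigma\in(1.586,\infty)$; (V) $\mathrm{PU}(x)$ increases from $\mathrm{EN}(x)$ to $\mathrm{BH}(x)$ as $\varepsilon$ increases from $0$ to $1$. (In (III)-(V), ''increases from $A$ to $B$'' as a parameter ranges over an open interval means: is increasing in the parameter, with limits $A$ and $B$ at the left and right endpoints of the interval.)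
   Context: Notation: $x_+:=\max(0,x)$, $x_+^\alpha:=(x_+)^\alpha$. For $a>0$, $\theta>0$, $\Gamma_{a^2}\sim N(0,a^2)$ and $\Pi_\theta\sim\mathrm{Pois}(\theta)$ are independent random variables, and $\tilde\Pi_\theta:=\Pi_\theta-\theta$. For a random variable $\eta$, $\alpha>0$ and $x\in\mathbb{R}$, $P_\alpha(\eta;x):=\inf_{t\in(-\infty,x)}\frac{\mathsf{E}(\eta-t)_+^\alpha}{(x-t)^\alpha}$. For $\sigma>0$, $y>0$, $\varepsilon\in(0,1)$ and $x\ge0$: $$\mathrm{BH}(x):=\exp\Big\{-\frac{\sigma^2}{y^2}\psi\Big(\frac{xy}{\sigma^2}\Big)\Big\},\quad\psi(u):=(1+u)\ln(1+u)-u;$$ $$\mathrm{PU}(x):=\inf_{\lambda>0}\exp\Big\{-\lambda x+\frac{\lambda^2}{2}(1-\varepsilon)\sigma^2+\frac{e^{\lambda y}-1-\lambda y}{y^2}\varepsilon\sigma^2\Big\};$$ $$\mathrm{Be}(x):=P_2\big(y\tilde\Pi_{\sigma^2/y^2};x\big);\qquad\mathrm{Pin}(x):=P_3\big(\Gamma_{(1-\varepsilon)\sigma^2}+y\tilde\Pi_{\varepsilon\sigma^2/y^2};x\big);$$ $$\mathrm{Ca}(x):=\frac{\sigma^2}{\sigma^2+x^2};\qquad\mathrm{EN}(x):=\exp\Big\{-\frac{x^2}{2\sigma^2}\Big\}.$$ *)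

(* Defs.v *)
From HB Require Import structures.
From mathcomp Require Import all_boot all_order all_algebra.
From mathcomp Require Import all_classical all_reals all_analysis.
Set Implicit Arguments.
Unset Strict Implicit.
Unset Printing Implicit Defensive.
Import Order.TTheory GRing.Theory Num.Theory numFieldNormedType.Exports.
Local Open Scope classical_set_scope.
Local Open Scope ring_scope.

Section laws.
Context d (T : measurableType d) (R : realType) (P : probability T R).

(* The law [normal_prob m s] has standard deviation [s], whereas the argument
   of [is_centered_normal] is the variance. *)
Definition is_centered_normal (X : {RV P >-> R}) (var : R) : Prop :=
  forall A : set R, measurable A ->
    distribution P X A = normal_prob 0 (Num.sqrt var) A.

(* The second argument of [poisson_prob] is a dummy: the law does not depend on
   it. *)
Definition is_poisson (X : {RV P >-> nat}) (theta : R) : Prop :=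
  forall A : set nat, measurable A ->
    distribution P X A = poisson_prob theta 0%N A.

Definition independent d1 d2 (T1 : measurableType d1) (T2 : measurableType d2)
    (X : {RV P >-> T1}) (Y : {RV P >-> T2}) : Prop :=
  forall (A : set T1) (B : set T2), measurable A -> measurable B ->
    P (X @^-1` A `&` Y @^-1` B) = (P (X @^-1` A) * P (Y @^-1` B))%E.

(* Extended-real valued, so that no finiteness of the moments is presupposed. *)
Definition Pbound (alpha : R) (eta : T -> R) (x : R) : \bar R :=
  ereal_inf [set ('E_P[(fun w => Num.max 0 (eta w - t) `^ alpha)%R]
                   * (((x - t) `^ alpha)^-1)%R%:E)%E | t in `]-oo, x[ ].

(* [N] stands for a Poisson variable of parameter [sigma ^+ 2 / y ^+ 2]. *)
Definition Be (N : {RV P >-> nat}) (sigma y x : R) : \bar R :=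
  Pbound 2 (fun w => y * ((N w)%:R - sigma ^+ 2 / y ^+ 2)) x.

(* [G] stands for a centered normal variable of variance
   [(1 - eps) * sigma ^+ 2] and [N] for an independent Poisson variable of
   parameter [eps * sigma ^+ 2 / y ^+ 2]. *)
Definition Pin (G : {RV P >-> R}) (N : {RV P >-> nat}) (sigma y eps x : R)
    : \bar R :=
  Pbound 3 (fun w => G w + y * ((N w)%:R - eps * sigma ^+ 2 / y ^+ 2)) x.

End laws.

Section explicit_bounds.
Context (R : realType).
Implicit Types sigma y eps x : R.

Definition psi (u : R) : R := (1 + u) * ln (1 + u) - u.

Definition BH sigma y x : R :=
  expR (- (sigma ^+ 2 / y ^+ 2 * psi (x * y / sigma ^+ 2))).

Definition PU sigma y eps x : R :=
  inf [set expR (- lambda * x + lambda ^+ 2 / 2 * (1 - eps) * sigma ^+ 2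
                 + (expR (lambda * y) - 1 - lambda * y) / y ^+ 2
                   * eps * sigma ^+ 2) | lambda in `]0, +oo[ ].

Definition Ca sigma x : R := sigma ^+ 2 / (sigma ^+ 2 + x ^+ 2).

Definition EN sigma x : R := expR (- (x ^+ 2 / (2 * sigma ^+ 2))).

Definition increasing_on (I : interval R) (f : R -> R) : Prop :=
  {in I &, {homo f : s t / s < t}}.

End explicit_bounds.

(* Main.v *)
Require Import Defs.
From mathcomp Require Import all_boot all_order all_algebra.
From mathcomp Require Import all_classical all_reals all_analysis.
From mathcomp Require Import measurable_realfun ring lra.
Import Order.TTheory GRing.Theory Num.Theory numFieldNormedType.Exports.
Local Open Scope classical_set_scope.
Local Open Scope ring_scope.

(** The explicit bounds are compared through their exponents.

    Put h(u) = psi(u) / u^2.  Then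
      BH(x) = exp(- (x^2 / sigma^2) h(x y / sigma^2)),
    and everything about y rests on the function h: it is strictly
    decreasing, because (2 + u) ln(1 + u) > 2 u, and it tends to 1/2 at 0 and
    to 0 at infinity ([psi_ratio_ltr], [psi_ratio_gt], [psi_ratio_lt]).  This
    gives (III).

    For (IV), with v = x / sigma and r = y / sigma, the inequality Ca < BH reads
    psi(r v) / r^2 < ln(1 + v^2), and Ca < EN reads v^2 / 2 < ln(1 + v^2).
    Both left-hand sides are convex functions bounded by v^2 / 2, and
    v^2 / 2 < ln(1 + v^2) on (0, 1], while ln(1 + v^2) is concave on
    [1, oo): so the difference changes sign exactly once ([crossing_exists]).
    The left-hand side decreases in r, hence the crossing point increases in r
    ([crossing_lt]); its limits follow from those of h.  The decimals of u_{0+}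
    come from cubic Taylor bounds for exp(v^2 / 32), squared four times.

    For (V), the exponent in PU(x) is A(lambda) + eps B(lambda), where A is the
    Gaussian exponent - lambda x + lambda^2 sigma^2 / 2 and B(lambda) > 0 for
    lambda > 0.  The infimum is attained ([PU_attained]), so that PU strictly
    increases in eps.  At eps = 0 the minimum of the exponent is that of A,
    which gives EN; at eps = 1 it is attained at ln(1 + x y / sigma^2) / y,
    which gives BH ([PU_expo1_opt], [PU_expo1_ge]).

    As for the moment bounds, max(0, v)^alpha <= exp(alpha (v - 1)), so P_alpha
    is bounded by each exponential moment bound
    ([Pbound_le_expectation_expR]); the moment generating functions of the
    normal and Poisson laws then yield Pin <= PU and Be <= BH.  The inequality
    Be <= Ca is Cantelli's: replace (eta - t)_+^2 by (eta - t)^2 and take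
    t = - sigma^2 / x.  Conversely, for x <= y the variable
    W = x eta + sigma^2 is nonnegative, since the compensated Poisson variable
    eta is at least - sigma^2 / y; then for c >= 0
      (eta - t)_+^2 >= 2 c (eta - t) W - c^2 W^2,
    and the best c turns the expectation of the right-hand side into
    (x - t)^2 Ca(x), whatever t is ([Ca_le_Be]). *)

Set Implicit Arguments.
Unset Strict Implicit.

(** * Elementary bounds for the logarithm and the exponential *)

Lemma is_derive_continuous (R : realType) (f : R -> R) (x df : R) :
  is_derive x 1 f df -> {for x, continuous f}.
Proof. by move=> d; apply/differentiable_continuous/derivable1_diffP. Qed.

Lemma is_derive_within (R : realType) (f df : R -> R) (a b : R) :
  (forall x, a <= x <= b -> is_derive x 1 f (df x)) ->
  {within `[a, b], continuous f}.
Proof.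
move=> d; apply: continuous_in_subspaceT => x; rewrite inE/= in_itv/= => /d.
exact: is_derive_continuous.
Qed.

Lemma derive_gt0_lt (R : realType) (f df : R -> R) (a b : R) :
  a < b -> (forall x, a <= x <= b -> is_derive x 1 f (df x)) ->
  (forall x, a < x < b -> 0 < df x) -> f a < f b.
Proof.
move=> ab d pos.
have [||c] := @MVT R f df a b ab.
- by move=> x; rewrite in_itv/= => /andP[ax xb]; apply: d; rewrite !ltW.
- exact: is_derive_within d.
rewrite in_itv/= => /pos dc e; rewrite -subr_gt0 e mulr_gt0// subr_gt0//.
Qed.

Lemma is_derive_ln1D (R : realType) (u : R) : -1 < u ->
  is_derive u 1 (fun u => ln (1 + u)) (1 + u)^-1.
Proof.
move=> u1.
have d1 : is_derive u 1 (fun u : R => 1 + u) 1.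
  by apply: is_derive_eq; ring.
have d2 : is_derive (1 + u) 1 (@ln R) (1 + u)^-1.
  by apply: is_derive1_ln; lra.
have := @is_derive1_comp R (@ln R) (fun u : R => 1 + u) u _ _ d2 d1.
by rewrite mulr1.
Qed.

(** The Pade approximant of the logarithm at 0.  The inequality is what makes
    [psi u / u ^+ 2] decrease, and it bounds [psi] from below with the right
    second-order term. *)
Lemma ln1D_gt (R : realType) (u : R) : 0 < u -> 2 * u / (2 + u) < ln (1 + u).
Proof.
move=> u0; rewrite -subr_gt0.
pose f (u : R) := ln (1 + u) - 2 * u * (2 + u)^-1.
have f0 : f 0 = 0 by rewrite /f mulr0 mul0r addr0 ln1 subr0.
rewrite -[X in X < _]f0.
apply: (@derive_gt0_lt R f (fun u => (1 + u)^-1 - 4 / (2 + u) ^+ 2)) => //.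
  move=> x /andP[x0 _]; have d := @is_derive_ln1D R x ltac:(lra).
  have n0 : 2 + x != 0 by apply/eqP; lra.
  have d2 := @is_deriveV R (fun x => 2 + x) x 1 _ n0 _.
  rewrite /f; apply: is_derive_eq.
  rewrite /GRing.scale/=; field; apply/andP; split; apply/eqP; lra.
move=> x /andP[x0 _].
have -> : (1 + x)^-1 - 4 / (2 + x) ^+ 2 = x ^+ 2 / ((1 + x) * (2 + x) ^+ 2).
  by field; apply/andP; split; apply/eqP; lra.
by rewrite divr_gt0// ?mulr_gt0 ?exprn_gt0//; lra.
Qed.

Lemma expR_gt_T2 (R : realType) (t : R) : 0 < t ->
  1 + t + t ^+ 2 / 2 < expR t.
Proof.
move=> t0; rewrite -subr_gt0.
pose f (t : R) := expR t - (1 + t + t ^+ 2 / 2).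
have f0 : f 0 = 0 by rewrite /f expR0; ring.
rewrite -[ltLHS]f0.
apply: (@derive_gt0_lt R f (fun t => expR t - (1 + t))) => //.
  by move=> x _; rewrite /f; apply: is_derive_eq; rewrite /GRing.scale/=; field.
by move=> x /andP[x0 _]; rewrite subr_gt0 expR_gt1Dx ?gt_eqF.
Qed.

Lemma expR_lt_T2 (R : realType) (t : R) : t < 0 ->
  expR t < 1 + t + t ^+ 2 / 2.
Proof.
move=> t0; rewrite -subr_lt0.
pose f (t : R) := expR t - (1 + t + t ^+ 2 / 2).
have f0 : f 0 = 0 by rewrite /f expR0; ring.
rewrite -[ltRHS]f0.
apply: (@derive_gt0_lt R f (fun t => expR t - (1 + t))) => //.
  by move=> x _; rewrite /f; apply: is_derive_eq; rewrite /GRing.scale/=; field.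
by move=> x /andP[_ x0]; rewrite subr_gt0 expR_gt1Dx ?lt_eqF.
Qed.

(** A Taylor polynomial of odd degree bounds the exponential from below on both
    sides of 0; the negative side is needed to bound [expR] from above, through
    its inverse. *)
Lemma expR_ge_T3 (R : realType) (t : R) :
  1 + t + t ^+ 2 / 2 + t ^+ 3 / 6 <= expR t.
Proof.
have [t0|t0|->] := ltgtP t 0; last by rewrite expR0; lra.
- rewrite -subr_ge0 -oppr_le0 ltW//.
  pose f (t : R) := - (expR t - (1 + t + t ^+ 2 / 2 + t ^+ 3 / 6)).
  have f0 : f 0 = 0 by rewrite /f expR0; ring.
  rewrite -[ltRHS]f0.
  apply: (@derive_gt0_lt R f (fun t => 1 + t + t ^+ 2 / 2 - expR t)) => //.
    by move=> x _; rewrite /f; apply: is_derive_eq; rewrite /GRing.scale/=; field.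
  by move=> x /andP[_ x0]; rewrite subr_gt0 expR_lt_T2.
- rewrite -subr_ge0 ltW//.
  pose f (t : R) := expR t - (1 + t + t ^+ 2 / 2 + t ^+ 3 / 6).
  have f0 : f 0 = 0 by rewrite /f expR0; ring.
  rewrite -[ltLHS]f0.
  apply: (@derive_gt0_lt R f (fun t => expR t - (1 + t + t ^+ 2 / 2))) => //.
    by move=> x _; rewrite /f; apply: is_derive_eq; rewrite /GRing.scale/=; field.
  by move=> x /andP[x0 _]; rewrite subr_gt0 expR_gt_T2.
Qed.

(** Lets a rational lower bound be rounded down after each squaring, so that
    the numerators and denominators stay small. *)
Lemma expR_double_ge (R : realType) (q q2 t : R) :
  0 <= q -> q <= expR t -> q2 <= q * q -> q2 <= expR (t + t).
Proof.
by move=> q0 qt; move/le_trans; apply; rewrite expRD ler_pM.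
Qed.

Lemma ln1Dsqr_le (R : realType) (w : R) : 0 <= w -> ln (1 + w ^+ 2) <= 2 * w.
Proof.
move=> w0; have le2 : ln (1 + w ^+ 2) <= ln ((1 + w) ^+ 2).
  have := sqr_ge0 w.
  by rewrite ler_ln ?posrE ?exprn_gt0//; nra.
apply: le_trans le2 _; rewrite lnXn; last lra.
rewrite mulr2n; have := @le_ln1Dx R w ltac:(lra); lra.
Qed.

(** * The exponent of BH and its limits in y *)

Lemma is_derive_psi (R : realType) (u : R) : -1 < u ->
  is_derive u 1 (@psi R) (ln (1 + u)).
Proof.
move=> u1; have d := is_derive_ln1D u1.
rewrite /psi; apply: is_derive_eq.
by rewrite /GRing.scale/=; field; apply/eqP; lra.
Qed.

Lemma psi_ge (R : realType) (u : R) : 0 < u -> u ^+ 2 / (2 + u) < psi u.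
Proof.
move=> u0; rewrite /psi.
have : (1 + u) * (2 * u / (2 + u)) < (1 + u) * ln (1 + u).
  by rewrite ltr_pM2l ?ln1D_gt//; lra.
have -> : u ^+ 2 / (2 + u) = (1 + u) * (2 * u / (2 + u)) - u.
  by field; apply/eqP; lra.
lra.
Qed.

Lemma psi_gt0 (R : realType) (u : R) : 0 < u -> 0 < psi u.
Proof.
by move=> u0; apply: le_lt_trans (psi_ge u0); rewrite divr_ge0 ?sqr_ge0//; lra.
Qed.

Lemma psi_lt (R : realType) (u : R) : 0 < u -> psi u < u ^+ 2 / 2.
Proof.
move=> u0; rewrite -subr_gt0.
pose f (u : R) := u ^+ 2 / 2 - psi u.
have f0 : f 0 = 0 by rewrite /f /psi addr0 ln1; lra.
rewrite -[X in X < _]f0.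
apply: (@derive_gt0_lt R f (fun u => u - ln (1 + u))) => //.
  move=> x /andP[x0 _]; have d := @is_derive_psi R x ltac:(lra).
  rewrite /f; apply: is_derive_eq.
  by rewrite /GRing.scale/=; field.
move=> x /andP[x0 _]; rewrite subr_gt0.
rewrite -[ltRHS]expRK ltr_ln ?posrE ?expR_gt0//; last lra.
by rewrite expR_gt1Dx// gt_eqF.
Qed.

(** [BH] is [expR] of [- (x / sigma) ^+ 2] times this ratio at
    [x * y / sigma ^+ 2], so that all its dependence on [y] sits here. *)
Definition psi_ratio (R : realType) (u : R) : R := psi u / u ^+ 2.

(** The derivative of [- psi_ratio] at [u] is
    [((2 + u) * ln (1 + u) - 2 * u) / u ^+ 3], whose sign is given by
    [ln1D_gt]. *)
Lemma psi_ratio_ltr (R : realType) (a b : R) : 0 < a -> a < b ->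
  psi_ratio b < psi_ratio a.
Proof.
move=> a0 ab; rewrite -ltrN2.
pose f (u : R) := - (psi u * (u ^+ 2)^-1).
apply: (@derive_gt0_lt R f
  (fun u => ((2 + u) * ln (1 + u) - 2 * u) / u ^+ 3)) => //.
  move=> x /andP[xa _]; have d := @is_derive_psi R x ltac:(lra).
  have n0 : x ^+ 2 != 0 by rewrite expf_neq0//; apply/eqP; lra.
  have d2 := @is_deriveV R (fun x => x ^+ 2) x 1 _ n0 _.
  rewrite /f; apply: is_derive_eq.
  rewrite /GRing.scale/= /psi; field; apply/eqP; lra.
move=> x /andP[x0 _]; rewrite divr_gt0 ?exprn_gt0//; try lra.
have := @ln1D_gt R x ltac:(lra).
rewrite ltr_pdivrMr; lra.
Qed.

Lemma psi_ratio_lt_half (R : realType) (u : R) : 0 < u -> psi_ratio u < 2^-1.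
Proof.
move=> u0; rewrite /psi_ratio ltr_pdivrMr ?exprn_gt0//.
by have := psi_lt u0; rewrite mulrC.
Qed.

Lemma psi_ratio_gt (R : realType) (u : R) : 0 < u -> (2 + u)^-1 < psi_ratio u.
Proof.
move=> u0; rewrite /psi_ratio ltr_pdivlMr ?exprn_gt0//.
by have := psi_ge u0; rewrite mulrC.
Qed.

Lemma psi_ratio_gt0 (R : realType) (u : R) : 0 < u -> 0 < psi_ratio u.
Proof. by move=> u0; rewrite /psi_ratio divr_gt0 ?psi_gt0 ?exprn_gt0. Qed.

(** With [u = w ^+ 2] the bound is [4 / Num.sqrt u], free of square roots; it
    comes from [ln (1 + w ^+ 2) <= 2 * w]. *)
Lemma psi_ratio_sqr_le (R : realType) (w : R) : 1 <= w ->
  psi_ratio (w ^+ 2) <= 4 / w.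
Proof.
move=> w1; have w0 : 0 < w by lra.
have -> : 4 / w = (4 * w ^+ 3) / (w ^+ 2) ^+ 2 by field; apply/eqP; lra.
rewrite /psi_ratio ler_pM2r ?invr_gt0 ?exprn_gt0// /psi.
have : (1 + w ^+ 2) * ln (1 + w ^+ 2) <= (1 + w ^+ 2) * (2 * w).
  rewrite ler_wpM2l ?ln1Dsqr_le// ?(ltW w0)//; have := sqr_ge0 w; lra.
have : 0 <= w * (w ^+ 2 - 1) by rewrite mulr_ge0//; nra.
have := sqr_ge0 w.
rewrite (exprS w 2); nra.
Qed.

Lemma psi_ratio_lt (R : realType) (e u : R) : 0 < e -> (1 + 4 / e) ^+ 2 < u ->
  psi_ratio u < e.
Proof.
move=> e0 hu; have q0 : 0 < 4 / e by rewrite divr_gt0.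
apply: lt_le_trans (psi_ratio_ltr _ hu) _; first by rewrite exprn_gt0//; lra.
apply: le_trans (psi_ratio_sqr_le _) _; first lra.
rewrite ler_pdivrMr; last lra.
by rewrite mulrDr mulr1 mulrCA divff ?mulr1 ?gt_eqF//; lra.
Qed.

Lemma BH_psi_ratio (R : realType) (sigma y x : R) : 0 < sigma -> 0 < y -> 0 < x ->
  BH sigma y x = expR (- (x ^+ 2 / sigma ^+ 2 * psi_ratio (x * y / sigma ^+ 2))).
Proof.
move=> s0 y0 x0; rewrite /BH /psi_ratio; congr (expR (- _)).
set p := psi _; field.
by repeat (apply/andP; split); rewrite ?expf_neq0 ?gt_eqF//.
Qed.

Lemma BH_increasing (R : realType) (sigma x : R) : 0 < sigma -> 0 < x ->
  increasing_on `]0, +oo[ (fun y => BH sigma y x).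
Proof.
move=> s0 x0 y z; rewrite !in_itv/= !andbT => y0 z0 yz.
rewrite !BH_psi_ratio// ltr_expR ltrN2 ltr_pM2l ?divr_gt0 ?exprn_gt0//.
have c0 : 0 < (sigma ^+ 2)^-1 by rewrite invr_gt0 exprn_gt0.
by rewrite psi_ratio_ltr ?mulr_gt0// ltr_pM2r// ltr_pM2l.
Qed.

Lemma EN_lt_BH (R : realType) (sigma y x : R) : 0 < sigma -> 0 < y -> 0 < x ->
  EN sigma x < BH sigma y x.
Proof.
move=> s0 y0 x0; rewrite BH_psi_ratio// /EN ltr_expR ltrN2.
rewrite [ltRHS](_ : _ = x ^+ 2 / sigma ^+ 2 * 2^-1).
  rewrite ltr_pM2l ?divr_gt0 ?exprn_gt0//.
  by rewrite psi_ratio_lt_half// divr_gt0 ?mulr_gt0 ?exprn_gt0.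
by field; rewrite gt_eqF.
Qed.

Lemma BH_cvg0 (R : realType) (sigma x : R) : 0 < sigma -> 0 < x ->
  BH sigma y x @[y --> 0^'+] --> EN sigma x.
Proof.
move=> s0 x0.
pose f y := expR (- (x ^+ 2 / sigma ^+ 2 * (2 + x * y / sigma ^+ 2)^-1)).
have fE : EN sigma x = f 0.
  rewrite /f /EN mulr0 mul0r addr0; congr (expR (- _)); field.
  by rewrite gt_eqF.
apply: (@squeeze_cvgr _ _ _ _ (cst (EN sigma x)) f).
- near=> y; have y0 : 0 < y by [].
  rewrite ltW/= ?EN_lt_BH//= BH_psi_ratio// /f ler_expR lerN2.
  rewrite ler_pM2l ?divr_gt0 ?exprn_gt0//.
  by rewrite ltW// psi_ratio_gt// divr_gt0 ?mulr_gt0 ?exprn_gt0.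
- exact: cvg_cst.
rewrite fE; apply: cvg_at_right_filter.
have n0 : 2 + x * 0 / sigma ^+ 2 != 0 by rewrite mulr0 mul0r addr0 pnatr_eq0.
have dI := @is_deriveV R (fun y : R => 2 + x * y / sigma ^+ 2) 0 1 _ n0 _.
apply: (@is_derive_continuous R f 0); rewrite /f; exact: is_derive_eq.
Unshelve. all: by end_near. Qed.

Lemma BH_cvgy (R : realType) (sigma x : R) : 0 < sigma -> 0 < x ->
  BH sigma y x @[y --> +oo] --> (1 : R).
Proof.
move=> s0 x0; pose a := x ^+ 2 / sigma ^+ 2.
have a0 : 0 < a by rewrite divr_gt0 ?exprn_gt0.
apply/cvgrPdist_lt => e e0.
near=> y.
have y0 : 0 < y by near: y; exact: nbhs_pinfty_gt.
rewrite BH_psi_ratio// -/a.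
set h := psi_ratio _.
have h0 : 0 < h by rewrite psi_ratio_gt0// divr_gt0 ?mulr_gt0 ?exprn_gt0.
have he : h < e / a.
  apply: psi_ratio_lt; first by rewrite divr_gt0.
  rewrite mulrAC -ltr_pdivrMl; last by rewrite divr_gt0// exprn_gt0.
  by near: y; apply: nbhs_pinfty_gt; rewrite num_real.
rewrite ger0_norm; last first.
  by rewrite subr_ge0 -expR0 ler_expR oppr_le0 ltW// mulr_gt0.
have := @expR_ge1Dx R (- (a * h)).
move: he; rewrite ltr_pdivlMr// mulrC; lra.
Unshelve. all: by end_near. Qed.

(** * The crossing point of Ca with BH and with EN *)

Lemma ln1Dsqr_gt (R : realType) (v : R) : 0 < v <= 1 ->
  v ^+ 2 / 2 < ln (1 + v ^+ 2).
Proof.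
move=> /andP[v0 v1]; have w0 : 0 < v ^+ 2 by rewrite exprn_gt0.
apply: le_lt_trans (ln1D_gt w0).
have w1 : v ^+ 2 <= 1 by rewrite expr_le1// ltW.
rewrite ler_pdivlMr; [nra|lra].
Qed.

Lemma is_derive_ln1Dsqr (R : realType) (v : R) :
  is_derive v 1 (fun v => ln (1 + v ^+ 2)) (2 * v / (1 + v ^+ 2)).
Proof.
have d1 : is_derive v 1 (fun v : R => 1 + v ^+ 2) (2 * v).
  by apply: is_derive_eq; rewrite /GRing.scale/=; ring.
have n0 : 0 < 1 + v ^+ 2 by have := sqr_ge0 v; lra.
have d2 := is_derive1_ln n0.
have := @is_derive1_comp R _ (fun u : R => 1 + u ^+ 2) v _ _ d2 d1.
by move=> d; apply: is_derive_eq; rewrite mulrC.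
Qed.

(** Here [u] and [v] stand for [x / sigma]: since
    [Ca sigma x = expR (- ln (1 + (x / sigma) ^+ 2))], the function [g] is the
    negated exponent of the bound that [Ca] is compared with. *)
Definition is_crossing (R : realType) (g : R -> R) (u : R) : Prop :=
  [/\ 0 < u, g u = ln (1 + u ^+ 2),
    forall v : R, 0 < v < u -> g v < ln (1 + v ^+ 2) &
    forall v : R, u < v -> ln (1 + v ^+ 2) < g v].

Lemma crossing_ge (R : realType) (g : R -> R) (u v : R) :
  is_crossing g u -> g v < ln (1 + v ^+ 2) -> v <= u.
Proof.
move=> [_ _ _ gr] gv; rewrite leNgt; apply/negP => /gr.
by move=> /(lt_trans gv); rewrite ltxx.
Qed.

Lemma crossing_le (R : realType) (g : R -> R) (u v : R) :
  is_crossing g u -> 0 < v -> ln (1 + v ^+ 2) < g v -> u <= v.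
Proof.
move=> [_ _ gl _] v0 gv; rewrite leNgt; apply/negP => vu.
by have := gl v; rewrite v0 vu => /(_ isT) /(lt_trans gv); rewrite ltxx.
Qed.

(** A lower curve [h] meets [ln (1 + v ^+ 2)] strictly later.  With [g], [h]
    from the family [BH_rate] this is the monotonicity in [y / sigma]; with [g]
    the exponent of [EN] it bounds the crossing points from below. *)
Lemma crossing_lt (R : realType) (g h : R -> R) (u w : R) :
  (forall v, 0 < v -> h v < g v) -> is_crossing g u -> is_crossing h w -> u < w.
Proof.
move=> hg [u0 gu _ _] hw; have := hg u u0; rewrite gu => hu.
rewrite lt_neqAle (crossing_ge hw hu) andbT; apply/eqP => uw.
by case: hw => _ + _ _; rewrite -uw => e; rewrite e ltxx in hu.
Qed.

(** On (0, 1] the difference D = ln (1 + v ^+ 2) - g v is positive.  Beyond 1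
    it is concave, because [v / (1 + v ^+ 2)] decreases there and [dg] does not
    decrease; so once D has come down to 0 it stays negative. *)
Lemma crossing_exists (R : realType) (g dg : R -> R) (b : R) :
  (forall v : R, 0 < v -> is_derive v 1 g (dg v)) ->
  (forall v w : R, 0 < v -> v <= w -> dg v <= dg w) ->
  (forall v : R, 0 < v -> g v <= v ^+ 2 / 2) ->
  0 < b -> ln (1 + b ^+ 2) < g b ->
  exists u, is_crossing g u.
Proof.
move=> dgP dgmono gub b0 bP.
pose D (v : R) := ln (1 + v ^+ 2) - g v.
pose dD (v : R) := 2 * v / (1 + v ^+ 2) - dg v.
have DP (v : R) : 0 < v -> is_derive v 1 D (dD v).
  move=> v0; have d1 := is_derive_ln1Dsqr v; have d2 := dgP v v0.
  by apply: is_derive_eq.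
have D01 (v : R) : 0 < v <= 1 -> 0 < D v.
  move=> v01; rewrite subr_gt0; apply: le_lt_trans (ln1Dsqr_gt v01).
  by apply: gub; case/andP: v01.
have dDmono (v w : R) : 1 <= v -> v <= w -> dD w <= dD v.
  move=> v1 vw; rewrite /dD lerB// ?dgmono//; last lra.
  have p (t : R) : 0 < 1 + t ^+ 2 by have := sqr_ge0 t; lra.
  rewrite ler_pdivrMr// mulrAC ler_pdivlMr//.
  have : 0 <= (w - v) * (v * w - 1).
    by rewrite mulr_ge0 ?subr_ge0//; nra.
  nra.
have Dcont (a c : R) : 0 < a -> {within `[a, c], continuous D}.
  move=> a0; apply: (@is_derive_within R D dD) => x /andP[ax _]; apply: DP.
  exact: lt_le_trans ax.
(* Being positive at 1 and nonpositive at v, D has a negative slope in between,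
   and its slope cannot increase any more. *)
have Dneg (v w : R) : 0 < v -> D v <= 0 -> v < w -> D w < 0.
  move=> v0 Dv vw.
  have v1 : 1 < v.
    rewrite ltNge; apply/negP => v1.
    by have := D01 v; rewrite v0 v1 => /(_ isT); lra.
  have [x||c1] := @MVT R D dD 1 v v1; rewrite ?in_itv//=.
  - by move=> /andP[x1 _]; apply: DP; lra.
  - by apply: Dcont.
  move=> /andP[c11 c1v] e1.
  have [x||c2] := @MVT R D dD v w vw; rewrite ?in_itv//=.
  - by move=> /andP[x1 _]; apply: DP; lra.
  - by apply: Dcont.
  move=> /andP[c2v c2w] e2.
  have D1 := D01 1; rewrite ltr01 lexx in D1; have {}D1 := D1 isT.
  have dc1 : dD c1 < 0.
    have v10 : 0 < v - 1 by lra.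
    by rewrite -(pmulr_llt0 _ v10) -e1; lra.
  have dc2 : dD c2 < 0 by apply: le_lt_trans dc1; apply: dDmono; lra.
  have : dD c2 * (w - v) < 0 by rewrite pmulr_llt0//; lra.
  lra.
have Db : D b < 0 by rewrite /D; lra.
have b1 : 1 < b.
  rewrite ltNge; apply/negP => b1.
  by have := D01 b; rewrite b0 b1 => /(_ isT); lra.
have D1 := D01 1; rewrite ltr01 lexx in D1; have {}D1 := D1 isT.
have [||c] := @IVT R D 1 b 0 (ltW b1).
- exact: Dcont.
- by rewrite ge_min le_max (ltW D1) (ltW Db) orbT.
rewrite in_itv/= => /andP[c1 cb] Dc.
exists c; split=> [||v|v]; [lra|by move: Dc; rewrite /D; lra| |].
  move=> /andP[v0 vc]; rewrite -subr_gt0 -/(D v) ltNge; apply/negP => Dv.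
  by have := Dneg v c v0 Dv vc; lra.
by move=> cv; rewrite -subr_lt0; apply: (Dneg c) => //; lra.
Qed.

(** The negated exponent of [BH] in the variables [r = y / sigma] and
    [v = x / sigma]. *)
Definition BH_rate (R : realType) (r v : R) : R := psi (r * v) / r ^+ 2.

Lemma BH_rateE (R : realType) (r v : R) : 0 < r -> 0 < v ->
  BH_rate r v = v ^+ 2 * psi_ratio (r * v).
Proof.
move=> r0 v0; rewrite /BH_rate /psi_ratio; set p := psi _; field.
by rewrite !gt_eqF.
Qed.

Lemma BH_expN_rate (R : realType) (sigma y x : R) : 0 < sigma -> 0 < y ->
  BH sigma y x = expR (- BH_rate (y / sigma) (x / sigma)).
Proof.
move=> s0 y0; rewrite /BH /BH_rate; congr (expR (- _)).
have -> : y / sigma * (x / sigma) = x * y / sigma ^+ 2.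
  by field; rewrite gt_eqF.
by field; rewrite !gt_eqF.
Qed.

Lemma Ca_ln (R : realType) (sigma x : R) : 0 < sigma ->
  Ca sigma x = expR (- ln (1 + (x / sigma) ^+ 2)).
Proof.
move=> s0; have p : 0 < 1 + (x / sigma) ^+ 2 by have := sqr_ge0 (x / sigma); lra.
rewrite expRN lnK ?posrE// /Ca; field.
have s2 : 0 < sigma ^+ 2 by rewrite exprn_gt0.
have s3 : 0 < sigma ^+ 2 + x ^+ 2 by rewrite ltr_wpDr ?sqr_ge0.
by rewrite !gt_eqF.
Qed.

Lemma BH_rate_lt_half (R : realType) (r v : R) : 0 < r -> 0 < v ->
  BH_rate r v < v ^+ 2 / 2.
Proof.
by move=> r0 v0; rewrite BH_rateE// ltr_pM2l ?psi_ratio_lt_half ?exprn_gt0 ?mulr_gt0.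
Qed.

Lemma BH_rate_decr (R : realType) (r s v : R) : 0 < r -> 0 < v -> r < s ->
  BH_rate s v < BH_rate r v.
Proof.
move=> r0 v0 rs; have s0 := lt_trans r0 rs.
by rewrite !BH_rateE// ltr_pM2l ?exprn_gt0// psi_ratio_ltr ?mulr_gt0// ltr_pM2r.
Qed.

(** The left-hand side is at most [2 * b], whereas [psi w >= (2 * r + 1) * w]
    once [ln (1 + w) >= 2 * r + 2]; take [b = w / r]. *)
Lemma BH_rate_gt_ln (R : realType) (r : R) : 0 < r ->
  exists2 b, 0 < b & ln (1 + b ^+ 2) < BH_rate r b.
Proof.
move=> r0; pose K := 2 * r + 1; pose w := expR (K + 1) - 1.
have w0 : 0 < w by rewrite subr_gt0 expR_gt1 /K; lra.
exists (w / r); first exact: divr_gt0.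
set b := w / r; have b0 : 0 < b by rewrite divr_gt0.
apply: le_lt_trans (ln1Dsqr_le (ltW b0)) _.
rewrite /BH_rate [r * b]mulrC divfK ?gt_eqF//.
rewrite ltr_pdivlMr ?exprn_gt0//.
have -> : psi w = (1 + w) * (K + 1) - w.
  by rewrite /psi [1 + w]addrC subrK expRK.
have -> : 2 * b * r ^+ 2 = 2 * r * w by rewrite /b; field; rewrite gt_eqF.
rewrite /K; nra.
Qed.

Lemma BH_crossing (R : realType) (r : R) : 0 < r ->
  exists u, is_crossing (BH_rate r) u.
Proof.
move=> r0; have [b b0 bP] := BH_rate_gt_ln r0.
apply: (@crossing_exists R _ (fun v => ln (1 + r * v) / r) b) => //.
- move=> v v0.
  have d1 : is_derive v 1 (fun v : R => r * v) r.
    by apply: is_derive_eq; rewrite /GRing.scale/=; ring.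
  have d2 := @is_derive_psi R (r * v) ltac:(have := mulr_gt0 r0 v0; lra).
  have d3 := @is_derive1_comp R _ (fun u : R => r * u) v _ _ d2 d1.
  rewrite /BH_rate.
  have d : is_derive v 1 (fun u => psi (r * u)) (ln (1 + r * v) * r) := d3.
  apply: is_derive_eq; rewrite /GRing.scale/=; field.
  by rewrite gt_eqF.
- move=> v w v0 vw; rewrite ler_pM2r ?invr_gt0//.
  have : r * v <= r * w by rewrite ler_pM2l.
  have := mulr_gt0 r0 v0.
  by move=> ? ?; rewrite ler_ln ?posrE; lra.
- by move=> v v0; rewrite ltW// BH_rate_lt_half.
Qed.

(** The inequality says that [expR (- v ^+ 2 / 2)] exceeds [(1 + v ^+ 2)^-1] at
    v = 1.585, with a relative margin of order 1e-4.  Sixteen factors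
    [expR (- v ^+ 2 / 32)] make the error of the cubic Taylor bound small
    enough. *)
Lemma ln_gt_half_sqr_1585 (R : realType) :
  (1585 / 1000) ^+ 2 / 2 < ln (1 + (1585 / 1000) ^+ 2) :> R.
Proof.
set s : R := (1585 / 1000) ^+ 2; pose t : R := - (s / 32).
have h0 := expR_ge_T3 t.
(* Each bound is rounded down to a fraction with denominator below 1500. *)
have h1 : 502 / 543 <= expR t.
  by apply: le_trans h0; rewrite /t /s; lra.
have h2 : 547 / 640 <= expR (t + t).
  by apply: expR_double_ge h1 _; lra.
have h3 : 805 / 1102 <= expR (t + t + (t + t)).
  by apply: expR_double_ge h2 _; lra.
set t4 := t + t + (t + t) in h3.
have h4 : 127 / 238 <= expR (t4 + t4).
  by apply: expR_double_ge h3 _; lra.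
have h5 : 377 / 1324 <= expR (t4 + t4 + (t4 + t4)).
  by apply: expR_double_ge h4 _; lra.
have e : t4 + t4 + (t4 + t4) = - (s / 2).
  by rewrite /t4 /t; field.
rewrite -[ltLHS]expRK ltr_ln ?posrE ?expR_gt0//; last by rewrite /s; lra.
rewrite -[ltLHS]invrK -expRN -e.
rewrite invf_plt ?posrE ?expR_gt0//; last by rewrite /s; lra.
apply: lt_le_trans h5; rewrite invf_plt ?posrE /s; lra.
Qed.

(** The same computation on the other side, where the margin is of order
    5e-4. *)
Lemma ln_lt_half_sqr_1586 (R : realType) :
  ln (1 + (1586 / 1000) ^+ 2) < (1586 / 1000) ^+ 2 / 2 :> R.
Proof.
set s : R := (1586 / 1000) ^+ 2; pose t : R := s / 32.
have h0 := expR_ge_T3 t.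
have h1 : 463 / 428 <= expR t.
  by apply: le_trans h0; rewrite /t /s; lra.
have h2 : 983 / 840 <= expR (t + t).
  by apply: expR_double_ge h1 _; lra.
have h3 : 1883 / 1375 <= expR (t + t + (t + t)).
  by apply: expR_double_ge h2 _; lra.
set t4 := t + t + (t + t) in h3.
have h4 : 1159 / 618 <= expR (t4 + t4).
  by apply: expR_double_ge h3 _; lra.
have h5 : 4822 / 1371 <= expR (t4 + t4 + (t4 + t4)).
  by apply: expR_double_ge h4 _; lra.
have e : t4 + t4 + (t4 + t4) = s / 2.
  by rewrite /t4 /t; field.
rewrite -[ltRHS]expRK ltr_ln ?posrE ?expR_gt0//; last by rewrite /s; lra.
rewrite -e; apply: lt_le_trans h5; rewrite /s; lra.
Qed.

Lemma EN_crossing (R : realType) :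
  exists2 u : R, 1585 / 1000 <= u < 1586 / 1000 &
    is_crossing (fun v => v ^+ 2 / 2) u.
Proof.
have b0 : 0 < 1586 / 1000 :> R by lra.
move: (ln_gt_half_sqr_1585 R) (ln_lt_half_sqr_1586 R) b0.
move: (1585 / 1000) (1586 / 1000) => a b la lb b0.
have [v _|//|//|u hu] :=
  @crossing_exists R (fun v => v ^+ 2 / 2) id b _ _ _ b0 lb.
  by apply: is_derive_eq; rewrite /GRing.scale/=; field.
exists u => //; rewrite (crossing_ge hu la)/= lt_neqAle.
rewrite (crossing_le hu b0 lb) andbT; apply/eqP => e.
by case: hu => _ + _ _; rewrite e => lbE; rewrite lbE ltxx in lb.
Qed.

Lemma BH_crossing_point (R : realType) :
  exists u : R -> R, forall r, 0 < r -> is_crossing (BH_rate r) (u r).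
Proof.
have [|u hu] :=
  (@choice R R (fun r u => 0 < r -> is_crossing (BH_rate r) u)); last by exists u.
move=> r; have [r0|r0] := ltP 0 r; last by exists 0.
by have [u] := BH_crossing r0; exists u.
Qed.

Lemma Ca_EN_compare (R : realType) (sigma x u : R) : 0 < sigma ->
  is_crossing (fun v => v ^+ 2 / 2) u ->
  (0 < x / sigma < u -> Ca sigma x < EN sigma x) /\
  (u < x / sigma -> EN sigma x < Ca sigma x).
Proof.
move=> s0 [_ _ hl hr].
have -> : EN sigma x = expR (- ((x / sigma) ^+ 2 / 2)).
  by rewrite /EN; congr (expR (- _)); field; rewrite gt_eqF.
by rewrite Ca_ln// !ltr_expR !ltrN2; split; [exact: hl|exact: hr].
Qed.

Lemma Ca_BH_compare (R : realType) (sigma y u : R) : 0 < sigma -> 0 < y ->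
  is_crossing (BH_rate (y / sigma)) u ->
  (forall x, 0 < x < sigma * u -> Ca sigma x < BH sigma y x) /\
  (forall x, sigma * u < x -> BH sigma y x < Ca sigma x).
Proof.
move=> s0 y0 [_ _ hl hr]; split=> x.
  move=> /andP[x0 xu]; rewrite Ca_ln// BH_expN_rate// ltr_expR ltrN2; apply: hl.
  by rewrite divr_gt0//= ltr_pdivrMr// mulrC.
move=> xu; rewrite Ca_ln// BH_expN_rate// ltr_expR ltrN2; apply: hr.
by rewrite ltr_pdivlMr// mulrC.
Qed.

Lemma crossing_increasing (R : realType) (u : R -> R) :
  (forall r, 0 < r -> is_crossing (BH_rate r) (u r)) -> increasing_on `]0, +oo[ u.
Proof.
move=> hu r s; rewrite !in_itv/= !andbT => r0 s0 rs.
by apply: crossing_lt (hu r r0) (hu s s0) => v v0; exact: BH_rate_decr.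
Qed.

(** Every [u r] exceeds [u0]; and for fixed [w > u0] the curve [BH_rate r] tends
    to the exponent of [EN], which is above [ln (1 + w ^+ 2)] at [w], so that
    [u r <= w] for small [r]. *)
Lemma crossing_cvg0 (R : realType) (u : R -> R) (u0 : R) :
  (forall r, 0 < r -> is_crossing (BH_rate r) (u r)) ->
  is_crossing (fun v => v ^+ 2 / 2) u0 -> u r @[r --> 0^'+] --> u0.
Proof.
move=> hu hu0; have [u0_gt0 _ _ hr0] := hu0.
apply/cvgrPdist_lt => e e0; pose w := u0 + e / 2.
have w0 : 0 < w by rewrite /w; lra.
have hw : ln (1 + w ^+ 2) < w ^+ 2 / 2 by apply: hr0; rewrite /w; lra.
have w2 : 0 < w ^+ 2 by rewrite exprn_gt0.
pose q := ln (1 + w ^+ 2) / w ^+ 2.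
have q0 : 0 < q by rewrite divr_gt0// ln_gt0//; lra.
have q2 : 2 < q^-1.
  by rewrite -(invrK 2) ltf_pV2 ?posrE ?invr_gt0// /q ltr_pdivrMr//; lra.
have c0 : 0 < (q^-1 - 2) / w by rewrite divr_gt0// subr_gt0.
near=> r.
have r0 : 0 < r by [].
have lo : u0 < u r.
  by apply: crossing_lt hu0 (hu r r0) => v v0; exact: BH_rate_lt_half.
suff : u r <= w by rewrite /w => hi; rewrite ltr0_norm ?subr_lt0//; lra.
apply: (crossing_le (hu r r0)) => //; rewrite BH_rateE// mulrC -ltr_pdivrMr// -/q.
apply: lt_trans (psi_ratio_gt _); last exact: mulr_gt0.
rewrite -(invrK q) ltf_pV2 ?posrE ?invr_gt0//.
  (* The remaining bound r < (q^-1 - 2) / w holds for r small enough. *)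
  by rewrite -ltrBrDl -ltr_pdivlMr.
by have := mulr_gt0 r0 w0; lra.
Unshelve. all: by end_near. Qed.

(** At a fixed [w] the curve tends to 0 as [r] grows, hence falls below
    [ln (1 + w ^+ 2)]. *)
Lemma crossing_cvgy (R : realType) (u : R -> R) :
  (forall r, 0 < r -> is_crossing (BH_rate r) (u r)) -> u r @[r --> +oo] --> +oo.
Proof.
move=> hu; apply/cvgryPge => M; near=> r.
have r0 : 0 < r by near: r; exact: nbhs_pinfty_gt.
pose w := Num.max 1 M.
have w0 : 0 < w by rewrite lt_max ltr01.
apply: (@le_trans _ _ w); first by rewrite le_max lexx orbT.
apply: (crossing_ge (hu r r0)); rewrite BH_rateE//.
have w2 : 0 < w ^+ 2 by rewrite exprn_gt0.
rewrite mulrC -ltr_pdivlMr//; apply: psi_ratio_lt.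
  by rewrite divr_gt0// ln_gt0; lra.
rewrite -ltr_pdivrMr//.
by near: r; apply: nbhs_pinfty_gt; rewrite num_real.
Unshelve. all: by end_near. Qed.

(** * Monotonicity and limits of PU in eps *)

Definition gauss_expo (R : realType) (sigma x lam : R) : R :=
  - lam * x + lam ^+ 2 / 2 * sigma ^+ 2.

(** What the exponent gains when the Gaussian component is replaced by the
    Poisson one of the same variance. *)
Definition poisson_excess (R : realType) (sigma y lam : R) : R :=
  ((expR (lam * y) - 1 - lam * y) / y ^+ 2 - lam ^+ 2 / 2) * sigma ^+ 2.

Definition PU_expo (R : realType) (sigma y eps x lam : R) : R :=
  gauss_expo sigma x lam + eps * poisson_excess sigma y lam.

Lemma PUE (R : realType) (sigma y eps x : R) :
  PU sigma y eps x =
  inf [set expR (PU_expo sigma y eps x lam) | lam in `]0, +oo[].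
Proof.
rewrite /PU; congr (inf [set expR _ | lam in _]).
by apply/funext => lam; rewrite /PU_expo /gauss_expo /poisson_excess; ring.
Qed.

Lemma PU_le (R : realType) (sigma y eps x lam : R) : 0 < lam ->
  PU sigma y eps x <= expR (PU_expo sigma y eps x lam).
Proof.
move=> l0; rewrite PUE; apply: ge_inf.
  by exists 0 => _ [l _ <-]; exact: expR_ge0.
by exists lam => //=; rewrite in_itv/= l0.
Qed.

Lemma PU_ge (R : realType) (sigma y eps x m : R) :
  (forall lam, 0 < lam -> m <= PU_expo sigma y eps x lam) ->
  expR m <= PU sigma y eps x.
Proof.
move=> h; rewrite PUE; apply: lb_le_inf.
  by exists (expR (PU_expo sigma y eps x 1)), 1 => //=; rewrite in_itv/= ltr01.
by move=> z [l /=]; rewrite in_itv/= andbT => l0 <-; rewrite ler_expR h.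
Qed.

Lemma poisson_excess_gt0 (R : realType) (sigma y lam : R) :
  0 < sigma -> 0 < y -> 0 < lam -> 0 < poisson_excess sigma y lam.
Proof.
move=> s0 y0 l0; rewrite mulr_gt0 ?exprn_gt0// subr_gt0.
rewrite ltr_pdivlMr ?exprn_gt0//.
have h := expR_gt_T2 (mulr_gt0 l0 y0).
have -> : lam ^+ 2 / 2 * y ^+ 2 = (lam * y) ^+ 2 / 2 by field.
lra.
Qed.

Lemma poisson_excess0 (R : realType) (sigma y : R) : poisson_excess sigma y 0 = 0.
Proof. by rewrite /poisson_excess mul0r expR0; ring. Qed.

Lemma poisson_excess_ge0 (R : realType) (sigma y lam : R) :
  0 < sigma -> 0 < y -> 0 <= lam -> 0 <= poisson_excess sigma y lam.
Proof.
move=> s0 y0; rewrite le_eqVlt => /orP[/eqP<-|l0]; first by rewrite poisson_excess0.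
by rewrite ltW// poisson_excess_gt0.
Qed.

Lemma gauss_expoE (R : realType) (sigma x lam : R) : 0 < sigma ->
  gauss_expo sigma x lam =
  - (x ^+ 2 / (2 * sigma ^+ 2)) + (lam * sigma - x / sigma) ^+ 2 / 2.
Proof.
by move=> s0; rewrite /gauss_expo; field; rewrite gt_eqF.
Qed.

Lemma gauss_expo_ge0 (R : realType) (sigma x lam : R) : 0 < sigma -> 0 < x ->
  2 * x / sigma ^+ 2 <= lam -> 0 <= gauss_expo sigma x lam.
Proof.
move=> s0 x0 hl; have s2 : 0 < sigma ^+ 2 by rewrite exprn_gt0.
have l0 : 0 <= lam by apply: le_trans hl; rewrite ltW// divr_gt0 ?mulr_gt0.
have -> : gauss_expo sigma x lam = lam * ((lam * sigma ^+ 2 - 2 * x) / 2).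
  by rewrite /gauss_expo; field.
by rewrite mulr_ge0// divr_ge0// subr_ge0 -ler_pdivrMr.
Qed.

(** The minimizer over [lam] of the exponent at [eps = 1]: there
    [expR (lam * y) = 1 + x * y / sigma ^+ 2]. *)
Definition BH_lam (R : realType) (sigma y x : R) : R :=
  ln (1 + x * y / sigma ^+ 2) / y.

Lemma BH_lam_gt0 (R : realType) (sigma y x : R) :
  0 < sigma -> 0 < y -> 0 < x -> 0 < BH_lam sigma y x.
Proof.
move=> s0 y0 x0; rewrite divr_gt0// ln_gt0// ltrDl.
by rewrite divr_gt0 ?mulr_gt0 ?exprn_gt0.
Qed.

Lemma PU_expo1E (R : realType) (sigma y x lam : R) : 0 < sigma -> 0 < y ->
  PU_expo sigma y 1 x lam = sigma ^+ 2 / y ^+ 2 *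
    (expR (lam * y) - 1 - lam * y * (1 + x * y / sigma ^+ 2)).
Proof.
move=> s0 y0; rewrite /PU_expo /gauss_expo /poisson_excess.
by set E := expR _; field; rewrite !gt_eqF.
Qed.

Lemma PU_expo1_opt (R : realType) (sigma y x : R) :
  0 < sigma -> 0 < y -> 0 < x ->
  PU_expo sigma y 1 x (BH_lam sigma y x) =
  - (sigma ^+ 2 / y ^+ 2 * psi (x * y / sigma ^+ 2)).
Proof.
move=> s0 y0 x0; rewrite PU_expo1E// -[RHS]mulrN; congr (_ * _).
rewrite /BH_lam /psi; set u := x * y / _.
have u0 : 0 < u by rewrite divr_gt0 ?mulr_gt0 ?exprn_gt0.
rewrite divfK ?gt_eqF// lnK ?posrE; last lra.
ring.
Qed.

(** By convexity [expR w] lies above its tangent at [ln (1 + u)], where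
    [w = lam * y] and [u = x * y / sigma ^+ 2]. *)
Lemma PU_expo1_ge (R : realType) (sigma y x lam : R) :
  0 < sigma -> 0 < y -> 0 < x ->
  - (sigma ^+ 2 / y ^+ 2 * psi (x * y / sigma ^+ 2)) <=
  PU_expo sigma y 1 x lam.
Proof.
move=> s0 y0 x0; rewrite PU_expo1E// -[leLHS]mulrN ler_pM2l ?divr_gt0 ?exprn_gt0//.
rewrite /psi; set u := x * y / _; set w := lam * y.
have u0 : 0 < u by rewrite divr_gt0 ?mulr_gt0 ?exprn_gt0.
have : (1 + u) * (1 + (w - ln (1 + u))) <= (1 + u) * expR (w - ln (1 + u)).
  by rewrite ler_pM2l ?expR_ge1Dx//; lra.
rewrite expRB lnK ?posrE; last lra.
rewrite [X in _ <= X](_ : _ = expR w); first lra.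
by rewrite mulrC divfK// gt_eqF//; lra.
Qed.

Lemma PU_expo_le1 (R : realType) (sigma y eps x lam : R) :
  0 < sigma -> 0 < y -> eps <= 1 -> 0 <= lam ->
  PU_expo sigma y eps x lam <= PU_expo sigma y 1 x lam.
Proof.
move=> s0 y0 e1 l0; rewrite /PU_expo lerD2l ler_wpM2r//.
exact: poisson_excess_ge0.
Qed.

Lemma PU_le_BH (R : realType) (sigma y eps x : R) :
  0 < sigma -> 0 < y -> eps <= 1 -> 0 < x -> PU sigma y eps x <= BH sigma y x.
Proof.
move=> s0 y0 e1 x0; have l0 := BH_lam_gt0 s0 y0 x0.
apply: le_trans (PU_le _ _ _ _ l0) _.
by rewrite ler_expR -PU_expo1_opt// PU_expo_le1// ltW.
Qed.

Lemma PU_expo_continuous (R : realType) (sigma y eps x : R) :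
  continuous (PU_expo sigma y eps x).
Proof.
move=> l; rewrite /PU_expo /gauss_expo /poisson_excess.
have d1 : is_derive l 1 (fun l : R => l * y) y.
  by apply: is_derive_eq; rewrite /GRing.scale/=; ring.
have d2 := @is_derive1_comp R _ (fun l : R => l * y) l _ _
  (is_derive_expR (l * y)) d1.
have d : is_derive l 1 (fun l => expR (l * y)) _ := d2.
by apply: (@is_derive_continuous R _ l); apply: is_derive_eq.
Qed.

(** The exponent vanishes at [lam = 0], is negative at [BH_lam], and is
    nonnegative beyond [2 * x / sigma ^+ 2]: a minimum over the compact
    interval in between is global and lies at a positive [lam]. *)
Lemma PU_attained (R : realType) (sigma y eps x : R) :
  0 < sigma -> 0 < y -> 0 <= eps <= 1 -> 0 < x ->
  exists2 lam, 0 < lam & PU sigma y eps x = expR (PU_expo sigma y eps x lam).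
Proof.
move=> s0 y0 /andP[e0 e1] x0; pose M := 2 * x / sigma ^+ 2.
have M0 : 0 < M by rewrite divr_gt0 ?mulr_gt0 ?exprn_gt0.
pose E := PU_expo sigma y eps x.
have E0 : E 0 = 0.
  by rewrite /E /PU_expo poisson_excess0 /gauss_expo; ring.
have EM l : M <= l -> 0 <= E l.
  move=> Ml; rewrite /E /PU_expo addr_ge0 ?gauss_expo_ge0//.
  by rewrite mulr_ge0// poisson_excess_ge0//; lra.
pose l1 := BH_lam sigma y x.
have l10 : 0 < l1 by exact: BH_lam_gt0.
have El1 : E l1 < 0.
  apply: le_lt_trans (PU_expo_le1 _ s0 y0 e1 (ltW l10)) _.
  rewrite PU_expo1_opt// oppr_lt0 mulr_gt0 ?divr_gt0 ?exprn_gt0//.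
  by rewrite psi_gt0// divr_gt0 ?mulr_gt0 ?exprn_gt0.
have l1M : l1 < M by rewrite ltNge; apply/negP => /EM; lra.
have [|c] := @EVT_min R E 0 M (ltW M0).
  by apply: continuous_subspaceT; exact: PU_expo_continuous.
rewrite in_itv/= => /andP[c0 cM] cmin.
have Ec : E c < 0.
  by apply: le_lt_trans El1; apply: cmin; rewrite in_itv/= !ltW.
have {}c0 : 0 < c.
  by rewrite lt_def c0 andbT; apply/eqP => cE; rewrite cE E0 ltxx in Ec.
exists c => //; apply/eqP; rewrite eq_le PU_le//=.
apply: PU_ge => l l0.
have [lM|Ml] := leP l M; first by apply: cmin; rewrite in_itv/= lM ltW.
by apply: le_trans (ltW Ec) (EM _ _); rewrite ltW.
Qed.

(** Evaluate the exponent of the smaller [eps] at a minimizer for the larger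
    one; strictness comes from the positivity of [poisson_excess] there, which
    is why the infimum has to be attained. *)
Lemma PU_increasing (R : realType) (sigma y x : R) :
  0 < sigma -> 0 < y -> 0 < x ->
  increasing_on `]0, 1[ (fun eps => PU sigma y eps x).
Proof.
move=> s0 y0 x0 e f; rewrite !in_itv/= => /andP[e0 e1] /andP[f0 f1] ef.
have [|lam l0 ->] := @PU_attained R sigma y f x s0 y0 _ x0.
  by rewrite !ltW.
apply: le_lt_trans (PU_le _ _ _ _ l0) _.
by rewrite ltr_expR ltrD2l ltr_pM2r// poisson_excess_gt0.
Qed.

Lemma PU_cvg0 (R : realType) (sigma y x : R) :
  0 < sigma -> 0 < y -> 0 < x ->
  PU sigma y eps x @[eps --> 0^'+] --> EN sigma x.
Proof.
move=> s0 y0 x0; pose l := x / sigma ^+ 2.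
have l0 : 0 < l by rewrite divr_gt0 ?exprn_gt0.
have gl : gauss_expo sigma x l = - (x ^+ 2 / (2 * sigma ^+ 2)).
  by rewrite gauss_expoE// /l; field; rewrite gt_eqF.
apply: (@squeeze_cvgr _ _ _ _ (cst (EN sigma x))
  (fun eps => expR (PU_expo sigma y eps x l))).
- near=> eps; have e0 : 0 < eps by [].
  rewrite PU_le// andbT; apply: PU_ge => lam l'0.
  rewrite /PU_expo gauss_expoE// -addrA lerDl addr_ge0//.
    by rewrite divr_ge0// sqr_ge0.
  by rewrite mulr_ge0 ?poisson_excess_ge0// ltW.
- exact: cvg_cst.
have -> : EN sigma x = expR (PU_expo sigma y 0 x l).
  by rewrite /PU_expo mul0r addr0 gl.
apply: cvg_at_right_filter.
by rewrite /PU_expo; apply: (@is_derive_continuous R _ 0); exact: is_derive_eq.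
Unshelve. all: by end_near. Qed.

(** Only [lam] up to [2 * x / sigma ^+ 2] matter, and there [poisson_excess] is
    bounded by a constant [C]; hence lowering [eps] from 1 lowers the exponent
    by at most [(1 - eps) * C]. *)
Lemma PU_cvg1 (R : realType) (sigma y x : R) :
  0 < sigma -> 0 < y -> 0 < x ->
  PU sigma y eps x @[eps --> 1^'-] --> BH sigma y x.
Proof.
move=> s0 y0 x0; pose M := 2 * x / sigma ^+ 2.
have M0 : 0 < M by rewrite divr_gt0 ?mulr_gt0 ?exprn_gt0.
pose p := - (sigma ^+ 2 / y ^+ 2 * psi (x * y / sigma ^+ 2)).
have p0 : p < 0.
  rewrite oppr_lt0 mulr_gt0 ?divr_gt0 ?exprn_gt0//.
  by rewrite psi_gt0// divr_gt0 ?mulr_gt0 ?exprn_gt0.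
pose C := expR (M * y) / y ^+ 2 * sigma ^+ 2.
have C0 : 0 < C by rewrite mulr_gt0 ?divr_gt0 ?expR_gt0 ?exprn_gt0.
have hC l : 0 < l -> l <= M -> poisson_excess sigma y l <= C.
  move=> l0 lM; rewrite ler_pM2r ?exprn_gt0//.
  apply: (@le_trans _ _ ((expR (l * y) - 1 - l * y) / y ^+ 2)).
    by rewrite lerBlDr lerDl divr_ge0// sqr_ge0.
  rewrite ler_pM2r ?invr_gt0 ?exprn_gt0//.
  have : expR (l * y) <= expR (M * y) by rewrite ler_expR ler_pM2r.
  by have := mulr_gt0 l0 y0; lra.
apply: (@squeeze_cvgr _ _ _ _
  (fun eps => expR (p - (1 - eps) * C)) (cst (BH sigma y x))).
- near=> eps; have e1 : eps < 1 by [].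
  have e0 : 0 < eps by near: eps; apply: nbhs_left_gt.
  rewrite (PU_le_BH s0 y0 (ltW e1) x0) andbT; apply: PU_ge => l l0.
  have ec : 0 < (1 - eps) * C by rewrite mulr_gt0// subr_gt0.
  have [lM|Ml] := leP l M; last first.
    apply: (@le_trans _ _ 0); first lra.
    rewrite /PU_expo addr_ge0 ?gauss_expo_ge0 ?ltW//.
    by rewrite mulr_gt0 ?poisson_excess_gt0.
  have -> : PU_expo sigma y eps x l = PU_expo sigma y 1 x l -
      (1 - eps) * poisson_excess sigma y l by rewrite /PU_expo; ring.
  rewrite lerB ?PU_expo1_ge// ler_wpM2l ?hC// subr_ge0 ltW//.
- have -> : BH sigma y x = expR (p - (1 - 1) * C).
    by rewrite subrr mul0r subr0.
  apply: cvg_at_left_filter.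
  by apply: (@is_derive_continuous R _ 1); exact: is_derive_eq.
- exact: cvg_cst.
Unshelve. all: by end_near. Qed.

(** * Independence, Poisson and normal integrals *)

(** Independence identifies the law of the pair with the product of the
    laws on rectangles, hence everywhere; Tonelli's theorem does the rest. *)
Lemma independent_expectation d d1 d2 (T : measurableType d)
    (T1 : measurableType d1) (T2 : measurableType d2) (R : realType)
    (P : probability T R) (X : {RV P >-> T1}) (Y : {RV P >-> T2})
    (f : T1 -> \bar R) (g : T2 -> \bar R) :
  independent X Y ->
  measurable_fun [set: T1] f -> measurable_fun [set: T2] g ->
  (forall a, (0 <= f a)%E) -> (forall b, (0 <= g b)%E) ->
  (\int[P]_w (f (X w) * g (Y w)) =
   (\int[P]_w f (X w)) * (\int[P]_w g (Y w)))%E.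
Proof.
move=> iXY mf mg f0 g0.
have mXY : measurable_fun setT (fun w => (X w, Y w)).
  by apply: measurable_fun_pair.
pose Z : {RV P >-> (T1 * T2)%type} := mfun_Sub (mem_set mXY).
have lawZ (A : set (T1 * T2)) : measurable A ->
    (distribution P X \x distribution P Y)%E A = distribution P Z A.
  move=> mA; apply: product_measure_unique; last exact: mA.
  move=> B C mB mC.
  change (P (X @^-1` B `&` Y @^-1` C) = P (X @^-1` B) * P (Y @^-1` C))%E.
  exact: iXY.
pose F (z : T1 * T2) := (f z.1 * g z.2)%E.
have mF : measurable_fun setT F.
  by apply: emeasurable_funM; apply: measurableT_comp.
have F0 z : (0 <= F z)%E by rewrite mule_ge0.
rewrite -[LHS](@ge0_integral_distribution _ _ _ _ _ _ Z F)//.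
rewrite (@eq_measure_integral _ _ _ setT
  (distribution P X \x distribution P Y)%E (distribution P Z) F); last first.
  by move=> A mA _; exact/esym/lawZ.
rewrite fubini_tonelli1//.
under eq_integral do rewrite /fubini_F /F/= ge0_integralZl//.
rewrite ge0_integralZr// ?integral_ge0//.
by rewrite !ge0_integral_distribution.
Qed.

Lemma integral_poisson d (T : measurableType d) (R : realType)
    (P : probability T R) (N : {RV P >-> nat}) (theta : R) (f : nat -> R) :
  0 < theta -> is_poisson N theta -> (forall k, 0 <= f k) ->
  (\int[P]_w (f (N w))%:E = \sum_(k <oo) (f k * poisson_pmf theta k)%:E)%E.
Proof.
move=> t0 hN f0.
pose A k := N @^-1` [set k].
have mA k : measurable (A k).
  by rewrite /A -[X in measurable X]setTI; exact: measurable_funP.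
have PA k : P (A k) = (poisson_pmf theta k)%:E.
  have := hN [set k] _; rewrite /distribution/= /pushforward/= => ->//.
  by rewrite /poisson_prob t0 esum_set1// lee_fin poisson_pmf_ge0.
have term0 k w : (0 <= (f k * \1_(A k) w)%:E)%E by rewrite lee_fin mulr_ge0.
transitivity (\int[P]_w \sum_(k <oo) (f k * \1_(A k) w)%:E)%E.
  apply: eq_integral => w _.
  rewrite (@nneseriesD1 _ _ (N w))//= eseries0 ?adde0.
    by rewrite indicE mem_set// mulr1.
  move=> k _ /= kN; rewrite indicE memNset ?mulr0//= => /= e.
  by rewrite e eqxx in kN.
rewrite integral_nneseries//.
  apply: eq_eseriesr => k _.
  under eq_integral do rewrite EFinM.
  rewrite ge0_integralZl_EFin//.
    rewrite integral_indic// setIT EFinM; congr (_ * _)%E; exact: PA.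
  exact/measurable_EFinP.
move=> k; apply/measurable_EFinP; exact: measurable_funM.
Qed.

Lemma poisson_pmf_series1 (R : realType) (theta : R) : 0 < theta ->
  (\sum_(k <oo) (poisson_pmf theta k)%:E = 1)%E.
Proof.
move=> t0; have := @probability_setT _ _ _ (poisson_prob theta 0%N).
rewrite /= /poisson_prob t0 => <-; rewrite nneseries_esumT//.
by move=> k; rewrite lee_fin poisson_pmf_ge0.
Qed.

(** The Stein-Chen identity: [k * poisson_pmf theta k] is
    [theta * poisson_pmf theta k.-1].  Applied to 1 and to the identity it gives
    the first two moments. *)
Lemma poisson_stein d (T : measurableType d) (R : realType)
    (P : probability T R) (N : {RV P >-> nat}) (theta : R) (f : nat -> R) :
  0 < theta -> is_poisson N theta -> (forall k, 0 <= f k) ->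
  (\int[P]_w ((N w)%:R * f (N w))%:E =
   theta%:E * \int[P]_w (f (N w).+1)%:E)%E.
Proof.
move=> t0 hN f0.
rewrite (@integral_poisson _ _ _ _ _ _ (fun k => k%:R * f k) t0 hN); last first.
  by move=> k; rewrite mulr_ge0.
rewrite (@integral_poisson _ _ _ _ _ _ (fun k => f k.+1) t0 hN)//.
have q0 k : (0 <= (k%:R * f k * poisson_pmf theta k)%:E)%E.
  by rewrite lee_fin !mulr_ge0// poisson_pmf_ge0.
rewrite nneseries_recl// !mul0r add0e -nneseries_addn// -nneseriesZl; last first.
  by move=> k _; rewrite lee_fin mulr_ge0// poisson_pmf_ge0.
apply: eq_eseriesr => k _; rewrite addn1 -EFinM; congr EFin.
rewrite /poisson_pmf t0 exprS factS natrM.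
field.
by rewrite nat1r !pnatr_eq0 -lt0n fact_gt0.
Qed.

(** Exponential tilting: [expR (a * k) * poisson_pmf theta k] is, up to the
    constant on the right, the mass function of the Poisson law of parameter
    [theta * expR a], which sums to 1. *)
Lemma poisson_mgf d (T : measurableType d) (R : realType)
    (P : probability T R) (N : {RV P >-> nat}) (theta a : R) :
  0 < theta -> is_poisson N theta ->
  (\int[P]_w (expR (a * (N w)%:R))%:E = (expR (theta * (expR a - 1)))%:E)%E.
Proof.
move=> t0 hN.
rewrite (@integral_poisson _ _ _ _ _ _ (fun k => expR (a * k%:R)) t0 hN)//.
have ta0 : 0 < theta * expR a by rewrite mulr_gt0 ?expR_gt0.
rewrite -[RHS]mule1 -(poisson_pmf_series1 ta0) -nneseriesZl; last first.
  by move=> k _; rewrite lee_fin poisson_pmf_ge0.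
apply: eq_eseriesr => k _; rewrite -EFinM; congr EFin.
rewrite /poisson_pmf t0 ta0 expRM_natr exprMn.
rewrite (_ : expR (- theta) = expR (theta * (expR a - 1)) * expR (- (theta * expR a))).
  ring.
by rewrite -expRD; congr expR; ring.
Qed.

Lemma integral_normal_prob (R : realType) (m s : R) (f : R -> \bar R) :
  measurable_fun [set: R] f -> (forall x, (0 <= f x)%E) ->
  (\int[normal_prob m s]_x f x =
   \int[lebesgue_measure]_x (f x * (normal_pdf m s x)%:E))%E.
Proof.
move=> mf f0; have dom := @normal_prob_dominates R m s.
rewrite -(Radon_Nikodym_SigmaFinite.change_of_variables dom)//.
have iRN := Radon_Nikodym_SigmaFinite.f_integrable dom.
apply: ae_eq_integral => //.
- by apply: emeasurable_funM => //; exact: (measurable_int lebesgue_measure).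
- apply: emeasurable_funM => //; apply/measurable_EFinP.
  exact: measurable_normal_pdf.
- apply: ae_eqe_mul2l; apply: integral_ae_eq => //.
    by apply/measurable_EFinP; exact: measurable_normal_pdf.
  by move=> E _ mE; rewrite -(Radon_Nikodym_SigmaFinite.f_integral dom).
Qed.

(** Completing the square turns [expR (a * x)] times the density into a constant
    times the density of mean [a * s ^+ 2]. *)
Lemma normal_mgf (R : realType) (s a : R) : s != 0 ->
  (\int[normal_prob 0 s]_x (expR (a * x))%:E =
   (expR (a ^+ 2 * s ^+ 2 / 2))%:E)%E.
Proof.
move=> s0; rewrite integral_normal_prob; first last.
- by move=> x; rewrite lee_fin expR_ge0.
- apply/measurable_EFinP; apply: measurableT_comp => //.
rewrite -[RHS]mule1 -(@integral_normal_pdf R (a * s ^+ 2) s).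
rewrite -ge0_integralZl_EFin ?expR_ge0//; last 2 first.
- by move=> x _; rewrite lee_fin normal_pdf_ge0.
- by apply/measurable_EFinP; exact: measurable_normal_pdf.
apply: eq_integral => x _; rewrite -!EFinM; congr EFin.
rewrite !normal_pdfE// mulrCA [RHS]mulrCA; congr (_ * _).
rewrite /normal_fun -!expRD; congr expR.
by field.
Qed.

(** The law [normal_prob] lives on [measurableTypeR R], whose measurable
    structure has the same measurable sets as that of [R] but is a different
    record; hence the copy [G'] of [G]. *)
Lemma centered_normal_mgf d (T : measurableType d) (R : realType)
    (P : probability T R) (G : {RV P >-> R}) (v a : R) :
  0 < v -> is_centered_normal G v ->
  (\int[P]_w (expR (a * G w))%:E = (expR (a ^+ 2 * v / 2))%:E)%E.
Proof.
move=> v0 hG.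
have mG : measurable_fun setT (G : T -> measurableTypeR R).
  exact: (measurable_funP G).
pose G' : {RV P >-> measurableTypeR R} :=
  @mfun_Sub _ _ T (measurableTypeR R) G (mem_set mG).
pose f (g : measurableTypeR R) := (expR (a * g))%:E.
have mf0 : measurable_fun setT (fun g : R => (expR (a * g))%:E).
  by apply/measurable_EFinP; apply: measurableT_comp.
have mf : measurable_fun setT f by exact: mf0.
have f0 g : (0 <= f g)%E by rewrite lee_fin expR_ge0.
rewrite -[LHS](ge0_integral_distribution G' mf f0).
rewrite (@eq_measure_integral _ _ _ setT (normal_prob 0 (Num.sqrt v))
  (distribution P G') f).
  by rewrite normal_mgf ?gt_eqF ?sqrtr_gt0// sqr_sqrtr// ltW.
by move=> A mA _; exact: hG.
Qed.

(** * The moment bounds Pin and Be *)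

(** For positive [v] this is [ln v <= v - 1], multiplied by [al]. *)
Lemma powR_le_expR (R : realType) (al v : R) : 0 < al ->
  Num.max 0 v `^ al <= expR (al * (v - 1)).
Proof.
move=> al0; have [v0|v0] := leP v 0.
  by rewrite powR0 ?expR_ge0 ?gt_eqF.
rewrite /powR gt_eqF// ler_expR ler_pM2l//.
by have := @le_ln1Dx R (v - 1) ltac:(lra); rewrite addrC subrK.
Qed.

Lemma measurable_pospart_powR d (T : measurableType d) (R : realType)
    (eta : T -> R) (t al : R) :
  measurable_fun setT eta ->
  measurable_fun setT (fun w => Num.max 0 (eta w - t) `^ al).
Proof.
move=> me; apply: (measurableT_comp (measurable_powR al)).
apply: measurable_maxr => //; exact: measurable_funB.
Qed.

Lemma Pbound_le d (T : measurableType d) (R : realType) (P : probability T R)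
    (al x t : R) (eta : T -> R) : t < x ->
  (Pbound P al eta x <=
   'E_P[(fun w => Num.max 0 (eta w - t) `^ al)%R]
     * (((x - t) `^ al)^-1)%R%:E)%E.
Proof.
by move=> tx; apply: ereal_inf_lbound; exists t => //=; rewrite in_itv.
Qed.

(** Choosing [t = x - al / lam] makes [al * ((eta - t) / (x - t) - 1)] equal to
    [lam * (eta - x)], so that [powR_le_expR] compares the integrands. *)
Lemma Pbound_le_expectation_expR d (T : measurableType d) (R : realType)
    (P : probability T R) (al x lam : R) (eta : T -> R) :
  0 < al -> 0 < lam -> measurable_fun setT eta ->
  (Pbound P al eta x <= \int[P]_w (expR (lam * (eta w - x)))%:E)%E.
Proof.
move=> al0 lam0 me; pose t := x - al / lam.
have xt : 0 < x - t by rewrite /t subKr divr_gt0.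
have tx : t < x by rewrite -subr_gt0.
apply: le_trans (Pbound_le P al eta tx) _.
rewrite expectation.unlock muleC -ge0_integralZl_EFin//; last 3 first.
- by move=> w _; rewrite lee_fin powR_ge0.
- by apply/measurable_EFinP; exact: measurable_pospart_powR.
- by rewrite invr_ge0 powR_ge0.
apply: ge0_le_integral => //.
- by move=> w _; rewrite mule_ge0// lee_fin ?invr_ge0 powR_ge0.
- apply/measurable_EFinP; apply: measurable_funM => //.
  exact: measurable_pospart_powR.
- apply/measurable_EFinP; apply: measurableT_comp => //.
  apply: measurable_funM => //; exact: measurable_funB.
move=> w _; rewrite -EFinM lee_fin.
have -> : lam * (eta w - x) = al * ((eta w - t) / (x - t) - 1).
  rewrite /t; field; rewrite gt_eqF//=.
  by apply/eqP; move: xt; rewrite /t; lra.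
apply: le_trans (powR_le_expR _ al0).
have -> : Num.max 0 ((eta w - t) / (x - t)) =
    Num.max 0 (eta w - t) / (x - t).
  by rewrite maxr_pMl ?mul0r// invr_ge0 ltW.
have iE : (x - t)^-1 `^ al = ((x - t) `^ al)^-1.
  by rewrite -(powR_inv1 (ltW xt)) -powRrM mulN1r powRN.
by rewrite powRM ?le_max ?lexx ?invr_ge0 ?(ltW xt)// iE mulrC.
Qed.

Lemma poisson_mean d (T : measurableType d) (R : realType)
    (P : probability T R) (N : {RV P >-> nat}) (theta : R) :
  0 < theta -> is_poisson N theta ->
  (\int[P]_w (N w)%:R%:E = theta%:E)%E.
Proof.
move=> t0 hN; have := @poisson_stein _ _ _ _ _ _ (fun=> 1) t0 hN ltac:(by []).
under eq_integral do rewrite mulr1.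
by move=> ->; rewrite integral_cst//= probability_setT !mule1.
Qed.

Lemma measurable_natr d (T : measurableType d) (R : realType)
    (P : probability T R) (N : {RV P >-> nat}) :
  measurable_fun setT (fun w => (N w)%:R : R).
Proof.
by apply: (@measurableT_comp _ _ _ _ _ _ (fun n : nat => n%:R : R) _ N).
Qed.

Lemma poisson_sqr d (T : measurableType d) (R : realType)
    (P : probability T R) (N : {RV P >-> nat}) (theta : R) :
  0 < theta -> is_poisson N theta ->
  (\int[P]_w ((N w)%:R ^+ 2)%:E = (theta * (theta + 1))%:E)%E.
Proof.
move=> t0 hN.
have := @poisson_stein _ _ _ _ _ _ (fun k => k%:R) t0 hN ltac:(by []).
under eq_integral do rewrite -expr2.
move=> ->; rewrite EFinM; congr (_ * _)%E.
under eq_integral do rewrite -natr1 EFinD.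
rewrite ge0_integralD//; last first.
  by apply/measurable_EFinP; exact: measurable_natr.
by rewrite (poisson_mean t0 hN) integral_cst//= probability_setT mule1.
Qed.

Lemma poisson_quadratic d (T : measurableType d) (R : realType)
    (P : probability T R) (N : {RV P >-> nat}) (theta a b c : R) :
  0 < theta -> is_poisson N theta ->
  P.-integrable setT (fun w => (a * (N w)%:R ^+ 2 + b * (N w)%:R + c)%:E) /\
  (\int[P]_w (a * (N w)%:R ^+ 2 + b * (N w)%:R + c)%:E =
   (a * (theta * (theta + 1)) + b * theta + c)%:E)%E.
Proof.
move=> t0 hN; have mN := @measurable_natr _ _ _ _ N.
have i1 : P.-integrable setT (fun w => (N w)%:R%:E : \bar R).
  apply/integrableP; split; first exact/measurable_EFinP.
  under eq_integral do rewrite gee0_abs ?lee_fin//.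
  by rewrite (poisson_mean t0 hN) ltry.
have i2 : P.-integrable setT (fun w => ((N w)%:R ^+ 2)%:E : \bar R).
  apply/integrableP; split; first by apply/measurable_EFinP; exact: measurable_funX.
  under eq_integral do rewrite gee0_abs ?lee_fin ?sqr_ge0//.
  by rewrite (poisson_sqr t0 hN) ltry.
have ic : P.-integrable setT (fun w => c%:E : \bar R).
  exact: finite_measure_integrable_cst.
have i2a := integrableZl measurableT a i2.
have i1b := integrableZl measurableT b i1.
have i3 := integrableD measurableT i2a i1b.
have eqf : (fun w => (a * (N w)%:R ^+ 2 + b * (N w)%:R + c)%:E : \bar R) =
  (fun w => (a%:E * ((N w)%:R ^+ 2)%:E + b%:E * (N w)%:R%:E) + c%:E)%E.
  by [].
rewrite eqf; split; first exact: (integrableD measurableT i3 ic).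
rewrite integralD// integralD// !integralZl// (poisson_mean t0 hN).
by rewrite (poisson_sqr t0 hN) integral_cst//= probability_setT mule1.
Qed.

(** The compensated variable [eta] has mean 0 and variance [sigma ^+ 2]. *)
Lemma compensated_poisson_quadratic d (T : measurableType d) (R : realType)
    (P : probability T R) (N : {RV P >-> nat}) (sigma y a b c : R)
    (eta := fun w => y * ((N w)%:R - sigma ^+ 2 / y ^+ 2)) :
  0 < sigma -> 0 < y -> is_poisson N (sigma ^+ 2 / y ^+ 2) ->
  P.-integrable setT (fun w => (a * eta w ^+ 2 + b * eta w + c)%:E) /\
  (\int[P]_w (a * eta w ^+ 2 + b * eta w + c)%:E =
   (a * sigma ^+ 2 + c)%:E)%E.
Proof.
move=> s0 y0 hN; set theta := sigma ^+ 2 / y ^+ 2 in eta hN *.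
have t0 : 0 < theta by rewrite divr_gt0 ?exprn_gt0.
have -> : (fun w => (a * eta w ^+ 2 + b * eta w + c)%:E : \bar R) =
  (fun w => (a * y ^+ 2 * (N w)%:R ^+ 2 +
     (b * y - 2 * a * y ^+ 2 * theta) * (N w)%:R +
     (a * y ^+ 2 * theta ^+ 2 - b * y * theta + c))%:E).
  by apply/funext => w; congr EFin; rewrite /eta; ring.
have [ii ->] := @poisson_quadratic _ _ _ _ N theta (a * y ^+ 2)
  (b * y - 2 * a * y ^+ 2 * theta)
  (a * y ^+ 2 * theta ^+ 2 - b * y * theta + c) t0 hN.
split=> //; congr EFin.
have -> : sigma ^+ 2 = y ^+ 2 * theta.
  by rewrite /theta mulrC divfK// expf_neq0// gt_eqF.
ring.
Qed.

Lemma measurable_compensated d (T : measurableType d) (R : realType)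
    (P : probability T R) (N : {RV P >-> nat}) (y theta : R) :
  measurable_fun setT (fun w => y * ((N w)%:R - theta)).
Proof.
apply: measurable_funM => //; apply: measurable_funB => //.
exact: measurable_natr.
Qed.

Lemma Be_le_second_moment d (T : measurableType d) (R : realType)
    (P : probability T R) (N : {RV P >-> nat}) (sigma y x t : R) :
  0 < sigma -> 0 < y -> is_poisson N (sigma ^+ 2 / y ^+ 2) -> t < x ->
  (Be N sigma y x <= ((sigma ^+ 2 + t ^+ 2) / (x - t) ^+ 2)%:E)%E.
Proof.
move=> s0 y0 hN tx; rewrite /Be; set eta := fun w => y * _.
apply: le_trans (Pbound_le P 2 eta tx) _.
have me : measurable_fun setT eta by exact: measurable_compensated.
have xt : 0 <= x - t by rewrite subr_ge0 ltW.
rewrite (powR_mulrn 2 xt) EFinM; apply: lee_wpmul2r.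
  by rewrite lee_fin invr_ge0 sqr_ge0.
rewrite expectation.unlock.
have [_ e] := compensated_poisson_quadratic 1 (- 2 * t) (t ^+ 2) s0 y0 hN.
rewrite mul1r in e; rewrite -e; apply: ge0_le_integral => //.
- by move=> w _; rewrite lee_fin powR_ge0.
- by apply/measurable_EFinP; exact: measurable_pospart_powR.
- apply/measurable_EFinP; apply: measurable_funD => //.
  apply: measurable_funD; apply: measurable_funM => //.
  exact: measurable_funX.
move=> w _; rewrite lee_fin powR_mulrn ?le_max ?lexx// -/(eta w).
have -> : 1 * eta w ^+ 2 + - 2 * t * eta w + t ^+ 2 = (eta w - t) ^+ 2 by ring.
have [h|h] := leP (eta w - t) 0; last by [].
by rewrite expr0n/= sqr_ge0.
Qed.

Lemma Be_le_Ca d (T : measurableType d) (R : realType)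
    (P : probability T R) (N : {RV P >-> nat}) (sigma y x : R) :
  0 < sigma -> 0 < y -> 0 < x -> is_poisson N (sigma ^+ 2 / y ^+ 2) ->
  (Be N sigma y x <= (Ca sigma x)%:E)%E.
Proof.
move=> s0 y0 x0 hN; pose t := - (sigma ^+ 2 / x).
have tx : t < x.
  by apply: (@lt_trans _ _ 0) => //; rewrite oppr_lt0 divr_gt0 ?exprn_gt0.
have -> : Ca sigma x = (sigma ^+ 2 + t ^+ 2) / (x - t) ^+ 2.
  have s2 : 0 < sigma ^+ 2 by rewrite exprn_gt0.
  have x2 : 0 < x ^+ 2 by rewrite exprn_gt0.
  rewrite /Ca /t; field; rewrite !gt_eqF//=; try lra.
exact: Be_le_second_moment.
Qed.

Lemma Be_le_BH d (T : measurableType d) (R : realType)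
    (P : probability T R) (N : {RV P >-> nat}) (sigma y x : R) :
  0 < sigma -> 0 < y -> 0 < x -> is_poisson N (sigma ^+ 2 / y ^+ 2) ->
  (Be N sigma y x <= (BH sigma y x)%:E)%E.
Proof.
move=> s0 y0 x0 hN; have l0 := BH_lam_gt0 s0 y0 x0.
have t0 : 0 < sigma ^+ 2 / y ^+ 2 by rewrite divr_gt0 ?exprn_gt0.
have mN := @measurable_compensated _ _ _ _ N y (sigma ^+ 2 / y ^+ 2).
have two : 0 < 2 :> R by [].
apply: le_trans (Pbound_le_expectation_expR P x two l0 mN) _.
set lam := BH_lam sigma y x in l0 *; set theta := _ / _ in hN t0 *.
under eq_integral.
  move=> w _.
  rewrite (_ : lam * _ = - lam * (y * theta + x) + lam * y * (N w)%:R); last ring.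
  rewrite expRD EFinM; over.
rewrite ge0_integralZl_EFin ?expR_ge0//; last first.
  apply/measurable_EFinP; apply: measurableT_comp => //.
  by apply: measurable_funM => //; exact: measurable_natr.
rewrite (poisson_mgf _ t0 hN) -EFinM -expRD lee_fin.
rewrite /BH -PU_expo1_opt// ler_expR -/lam /PU_expo /gauss_expo /poisson_excess.
rewrite le_eqVlt; apply/orP; left; apply/eqP; rewrite /theta.
by set E := expR _; field; rewrite gt_eqF.
Qed.

(** A duality argument: the nonnegative variable W = x eta + sigma^2 certifies
    the same lower bound for every [t], by
    (eta - t)_+ ^ 2 >= 2 c (eta - t) W - c^2 W^2, with the optimal c. *)
Lemma Ca_le_Be d (T : measurableType d) (R : realType)
    (P : probability T R) (N : {RV P >-> nat}) (sigma y x : R) :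
  0 < sigma -> 0 < y -> 0 <= x <= y -> is_poisson N (sigma ^+ 2 / y ^+ 2) ->
  ((Ca sigma x)%:E <= Be N sigma y x)%E.
Proof.
move=> s0 y0 /andP[x0 xy] hN; apply: le_ereal_inf_tmp.
move=> z [t /=]; rewrite in_itv/= => tx <-.
pose eta w := y * ((N w)%:R - sigma ^+ 2 / y ^+ 2).
rewrite -[X in (_ <= X * _)%E]/('E_P[(fun w => Num.max 0 (eta w - t) `^ 2)%R])%E.
have me : measurable_fun setT eta by exact: measurable_compensated.
have xt : 0 < x - t by rewrite subr_gt0.
have s2 : 0 < sigma ^+ 2 by rewrite exprn_gt0.
have q0 : 0 < sigma ^+ 2 + x ^+ 2 by rewrite ltr_wpDr ?sqr_ge0.
rewrite (powR_mulrn 2 (ltW xt)) expectation.unlock.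
pose c := (x - t) / (sigma ^+ 2 + x ^+ 2).
have c0 : 0 <= c by rewrite divr_ge0// ltW.
pose W w := x * eta w + sigma ^+ 2.
(* Here x <= y enters: the smallest value of eta is - sigma^2 / y. *)
have W0 w : 0 <= W w.
  have -> : W w = x * y * (N w)%:R + sigma ^+ 2 * (1 - x / y).
    by rewrite /W /eta; field; rewrite gt_eqF.
  apply: addr_ge0; first by rewrite !mulr_ge0// ltW.
  apply: mulr_ge0; first exact: ltW.
  by rewrite subr_ge0 ler_pdivrMr// mul1r.
(* The coefficients of 2 c (eta - t) W - (c W)^2 as a polynomial in eta. *)
pose A := 2 * c * x - c ^+ 2 * x ^+ 2.
pose B := 2 * c * (sigma ^+ 2 - t * x) - 2 * c ^+ 2 * x * sigma ^+ 2.
pose C := - (2 * c * t * sigma ^+ 2) - c ^+ 2 * sigma ^+ 4.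
have [iq eq] := compensated_poisson_quadratic A B C s0 y0 hN.
have [iq2 _] := compensated_poisson_quadratic 1 (- 2 * t) (t ^+ 2) s0 y0 hN.
have imax : P.-integrable setT
    (fun w => (Num.max 0 (eta w - t) `^ 2)%:E : \bar R).
  apply: le_integrable iq2 => //.
    by apply/measurable_EFinP; exact: measurable_pospart_powR.
  move=> w _; rewrite -/(eta w) mul1r.
  have -> : eta w ^+ 2 + - 2 * t * eta w + t ^+ 2 = (eta w - t) ^+ 2 by ring.
  rewrite !gee0_abs ?lee_fin ?powR_ge0 ?sqr_ge0//.
  rewrite powR_mulrn ?le_max ?lexx//.
  have [h|h] := leP (eta w - t) 0; last by [].
  by rewrite expr0n/= sqr_ge0.
have -> : Ca sigma x = (A * sigma ^+ 2 + C) * ((x - t) ^+ 2)^-1.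
  rewrite /A /C /c /Ca; field.
  by rewrite !gt_eqF.
rewrite EFinM; apply: lee_wpmul2r; first by rewrite lee_fin invr_ge0 sqr_ge0.
rewrite -eq; apply: le_integral => // w _; rewrite lee_fin -/(eta w).
rewrite powR_mulrn ?le_max ?lexx//; set m := Num.max 0 _.
have mle : eta w - t <= m by rewrite le_max lexx orbT.
have -> : A * eta w ^+ 2 + B * eta w + C =
    2 * c * (eta w - t) * W w - (c * W w) ^+ 2.
  by rewrite /A /B /C /W; ring.
have h1 : (eta w - t) * (c * W w) <= m * (c * W w).
  by rewrite ler_wpM2r// mulr_ge0.
have := sqr_ge0 (m - c * W w).
rewrite sqrrB; lra.
Qed.

(** For x > 0 the upper bound is attained at t = - sigma^2 / x, which escapes
    to - oo as x tends to 0; for x = 0 an approximation is therefore needed. *)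
Lemma Be_eq_Ca d (T : measurableType d) (R : realType)
    (P : probability T R) (N : {RV P >-> nat}) (sigma y x : R) :
  0 < sigma -> 0 < y -> 0 <= x <= y -> is_poisson N (sigma ^+ 2 / y ^+ 2) ->
  Be N sigma y x = (Ca sigma x)%:E.
Proof.
move=> s0 y0 /[dup] xy /andP[x0 _] hN.
apply/eqP; rewrite eq_le Ca_le_Be// andbT.
have [x1|x1|<-] := ltgtP 0 x; [exact: Be_le_Ca| by move: x1; rewrite ltNge x0|].
(* This t makes sigma^2 / t^2 at most e, as (1 + 1/e)^2 >= 1/e. *)
apply/lee_addgt0Pr => e e0; pose t := - (sigma * (1 + e^-1)).
have ei : 0 < e^-1 by rewrite invr_gt0.
have t0 : t < 0 by rewrite oppr_lt0 mulr_gt0// addr_gt0.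
apply: le_trans (Be_le_second_moment s0 y0 hN t0) _.
rewrite -EFinD lee_fin /Ca expr0n/= addr0 divff ?expf_neq0 ?gt_eqF//.
have -> : (sigma ^+ 2 + t ^+ 2) / (0 - t) ^+ 2 = 1 + ((1 + e^-1) ^+ 2)^-1.
  rewrite /t sub0r opprK sqrrN exprMn; field.
  by rewrite !gt_eqF//; lra.
rewrite lerD2l -[leRHS]invrK lef_pV2 ?posrE ?exprn_gt0//; last lra.
nra.
Qed.

Lemma Pin_le_PU d (T : measurableType d) (R : realType)
    (P : probability T R) (G : {RV P >-> R}) (N : {RV P >-> nat})
    (sigma y eps x : R) :
  0 < sigma -> 0 < y -> 0 < eps < 1 -> 0 < x ->
  is_centered_normal G ((1 - eps) * sigma ^+ 2) ->
  is_poisson N (eps * sigma ^+ 2 / y ^+ 2) -> independent G N ->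
  (Pin G N sigma y eps x <= (PU sigma y eps x)%:E)%E.
Proof.
move=> s0 y0 /andP[e0 e1] x0 hG hN iGN.
have e1' : 0 < 1 - eps by rewrite subr_gt0.
have v0 : 0 < (1 - eps) * sigma ^+ 2 by rewrite mulr_gt0 ?exprn_gt0.
have t0 : 0 < eps * sigma ^+ 2 / y ^+ 2 by rewrite divr_gt0 ?mulr_gt0 ?exprn_gt0.
have key lam : 0 < lam ->
    (Pin G N sigma y eps x <= (expR (PU_expo sigma y eps x lam))%:E)%E.
  move=> l0; rewrite /Pin; have three : 0 < 3 :> R by [].
  set theta := _ / y ^+ 2 in t0 hN *.
  have mG : measurable_fun setT (G : T -> R) by exact: measurable_funP.
  have me : measurable_fun setT (fun w => G w + y * ((N w)%:R - theta)).
    by apply: measurable_funD => //; exact: measurable_compensated.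
  apply: le_trans (Pbound_le_expectation_expR P x three l0 me) _.
  pose K := expR (- lam * (y * theta + x)).
  pose f (g : R) := (expR (lam * g))%:E.
  pose h (n : nat) := (K * expR (lam * y * n%:R))%:E.
  have mf : measurable_fun setT f.
    by apply/measurable_EFinP; apply: measurableT_comp.
  rewrite (_ : (\int[P]_w _)%E = (\int[P]_w (f (G w) * h (N w)))%E); last first.
    apply: eq_integral => w _; rewrite -EFinM /K -!expRD; congr (expR _)%:E.
    ring.
  rewrite (independent_expectation iGN mf)//; first last.
  - by move=> n; rewrite lee_fin mulr_ge0 ?expR_ge0.
  - by move=> g; rewrite lee_fin expR_ge0.
  have -> : (\int[P]_w f (G w) =
      (expR (lam ^+ 2 * ((1 - eps) * sigma ^+ 2) / 2))%:E)%E.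
    exact: centered_normal_mgf.
  have -> : (\int[P]_w h (N w) =
      (K * expR (theta * (expR (lam * y) - 1)))%:E)%E.
    under eq_integral do rewrite /h EFinM.
    rewrite ge0_integralZl_EFin ?expR_ge0//; last first.
      apply/measurable_EFinP; apply: measurableT_comp => //.
      by apply: measurable_funM => //; exact: measurable_natr.
    by rewrite (poisson_mgf _ t0 hN).
  rewrite -EFinM lee_fin /K -!expRD ler_expR le_eqVlt.
  apply/orP; left; apply/eqP.
  rewrite /PU_expo /gauss_expo /poisson_excess /theta.
  by set E := expR _; field; rewrite gt_eqF.
have := key 1 ltr01; case E : (Pin G N sigma y eps x) => [p| |] //= _; last first.
  by rewrite leNye.
rewrite lee_fin PUE; apply: lb_le_inf.
  by exists (expR (PU_expo sigma y eps x 1)), 1 => //=; rewrite in_itv/= ltr01.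
move=> z [l /=]; rewrite in_itv/= andbT => l0 <-.
by have := key l l0; rewrite E lee_fin.
Qed.

Theorem proposition3p7 (R : realType) :
  (* (I) *)
  ((forall (sigma y eps x : R),
      0 < sigma -> 0 < y -> 0 < eps < 1 -> 0 < x ->
      (forall (d : measure_display) (T : measurableType d)
          (P : probability T R) (G : {RV P >-> R}) (N : {RV P >-> nat}),
        is_centered_normal G ((1 - eps) * sigma ^+ 2) ->
        is_poisson N (eps * sigma ^+ 2 / y ^+ 2) ->
        independent G N ->
        (Pin G N sigma y eps x <= (PU sigma y eps x)%:E)%E)
      /\ PU sigma y eps x <= BH sigma y x)
   /\
   (forall (sigma y x : R), 0 < sigma -> 0 < y -> 0 < x ->
      forall (d : measure_display) (T : measurableType d)
          (P : probability T R) (N : {RV P >-> nat}),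
        is_poisson N (sigma ^+ 2 / y ^+ 2) ->
        (Be N sigma y x <= (Num.min (Ca sigma x) (BH sigma y x))%:E)%E))
  /\
  (* (II) *)
  (forall (sigma y x : R), 0 < sigma -> 0 < y -> 0 <= x <= y ->
     forall (d : measure_display) (T : measurableType d)
         (P : probability T R) (N : {RV P >-> nat}),
       is_poisson N (sigma ^+ 2 / y ^+ 2) ->
       Be N sigma y x = (Ca sigma x)%:E)
  /\
  (* (III) *)
  (forall (sigma x : R), 0 < sigma -> 0 < x ->
     [/\ increasing_on `]0, +oo[ (fun y => BH sigma y x),
         BH sigma y x @[y --> 0^'+] --> EN sigma x
       & BH sigma y x @[y --> +oo] --> (1 : R)])
  /\
  (* (IV) *)
  ((exists u : R -> R,
     [/\ forall r : R, 0 < r -> 0 < u r,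
         forall (sigma y : R), 0 < sigma -> 0 < y ->
           (forall x : R, 0 < x < sigma * u (y / sigma) ->
              Ca sigma x < BH sigma y x)
           /\ (forall x : R, sigma * u (y / sigma) < x ->
              Ca sigma x > BH sigma y x),
         increasing_on `]0, +oo[ u,
         exists2 u0 : R, 1585 / 1000 <= u0 < 1586 / 1000
                       & u r @[r --> 0^'+] --> u0
       & u r @[r --> +oo] --> +oo])
   /\
   (forall (sigma x : R), 0 < sigma ->
      (0 < x / sigma < 1585 / 1000 -> Ca sigma x < EN sigma x)
      /\ (1586 / 1000 < x / sigma -> Ca sigma x > EN sigma x)))
  /\
  (* (V) *)
  (forall (sigma y x : R), 0 < sigma -> 0 < y -> 0 < x ->
     [/\ increasing_on `]0, 1[ (fun eps => PU sigma y eps x),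
         PU sigma y eps x @[eps --> 0^'+] --> EN sigma x
       & PU sigma y eps x @[eps --> 1^'-] --> BH sigma y x]).
Proof.
have [u0 u0P EN_u0] := EN_crossing R.
have [u hu] := BH_crossing_point R.
split; [split|split; [|split; [|split]]].
- move=> sigma y eps x s0 y0 e01 x0; split.
    by move=> d T P G N hG hN iGN; exact: Pin_le_PU.
  by apply: PU_le_BH => //; case/andP: e01 => _ /ltW.
- move=> sigma y x s0 y0 x0 d T P N hN.
  have [_|_] := leP (Ca sigma x) (BH sigma y x); first exact: Be_le_Ca hN.
  exact: Be_le_BH hN.
- by move=> sigma y x s0 y0 xy d T P N hN; exact: Be_eq_Ca.
- move=> sigma x s0 x0.
  by split; [exact: BH_increasing|exact: BH_cvg0|exact: BH_cvgy].
- split.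
    exists u; split.
    + by move=> r /hu[].
    + move=> sigma y s0 y0; apply: Ca_BH_compare => //.
      by apply: hu; rewrite divr_gt0.
    + exact: crossing_increasing.
    + by exists u0 => //; exact: crossing_cvg0.
    + exact: crossing_cvgy.
  move=> sigma x s0; have [hl hr] := @Ca_EN_compare R sigma x u0 s0 EN_u0.
  move/andP: u0P => [u0l u0r]; split.
    by move=> /andP[v0 v1]; apply: hl; rewrite v0 (lt_le_trans v1 u0l).
  by move=> v1; apply: hr; apply: lt_trans v1.
- move=> sigma y x s0 y0 x0.
  by split; [exact: PU_increasing|exact: PU_cvg0|exact: PU_cvg1].
Qed.
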